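(* Let $(M,g_L,Z,\lambda,\rho)$ be a Lyra almost Ricci--Bourguignon soliton on a connected Lyra twisted warped product $M=M_1\times_fM_2$ of dimension $n\ge3$. If $Z$ is Lyra homothetic with constant factor $c\in\mathbb R$, then $g_L$ is Einstein, $\operatorname{Ric}^L=\mu g_L$ with $\mu$ constant, and $$\lambda=(1-n\rho)\mu+c .$$ In particular $\lambda$ is constant. If $\rho\neq\frac1n$, then $\mu=\frac{\lambda-c}{1-n\rho}$. If $\rho=\frac1n$, then necessarily $\lambda=c$.
   Context: Lyra twisted warped product: $(M_1,g_1),(M_2,g_2)$ are smooth pseudo-Riemannian manifolds of positive dimensions $n_1,n_2$, $n=n_1+n_2$; $f,\varphi:M_1\times M_2\to(0,\infty)$ are smooth; $M=M_1\times M_2$ carries $g=g_1\oplus f^2g_2$ and $g_L=\varphi^2g$. $\operatorname{Ric}^L,R^L$ are the Ricci tensor and scalar curvature of $g_L$. A Lyra almost Ricci--Bourguignon soliton is $(g_L,Z,\lambda,\rho)$ with $Z$ a smooth vector field on $M$, $\lambda\in C^\infty(M)$, $\rho\in\mathbb R$, satisfying $\operatorname{Ric}^L+\frac12\mathcal L_Zg_L=(\lambda+\rho R^L)g_L$. $Z$ is Lyra homothetic with factor $c$ if $\mathcal L_Zg_L=2c\,g_L$ with $c$ constant. $g_L$ is Einstein if $\operatorname{Ric}^L=\mu g_L$ for some constant $\mu\in\mathbb R$. *)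

(* Defs.v *)
From HB Require Import structures.
From mathcomp Require Import all_boot all_order all_algebra.
From mathcomp Require Import all_classical all_reals all_analysis.

Set Implicit Arguments.
Unset Strict Implicit.
Unset Printing Implicit Defensive.
Import Order.TTheory GRing.Theory Num.Theory.
Import numFieldNormedType.Exports.
Local Open Scope classical_set_scope.
Local Open Scope ring_scope.

(* C^oo functions on an open subset of R^n: all iterated partial derivatives  *)
(* exist and are continuous.                                                  *)
Section SmoothRn.
Variables (R : realType) (n : nat).
Implicit Types (f g : 'rV[R]_n -> R) (U V : set 'rV[R]_n) (x : 'rV[R]_n).

Definition partial (i : 'I_n) f : 'rV[R]_n -> R :=
  fun x => 'D_(delta_mx 0 i : 'rV[R]_n) f x.

Definition partials (s : seq 'I_n) f : 'rV[R]_n -> R := foldr partial f s.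

Definition smooth_on U f : Prop := forall s x, U x ->
  {for x, continuous (partials s f)} /\
  forall i : 'I_n, derivable (partials s f) x (delta_mx 0 i : 'rV[R]_n).

Definition C1_on U f : Prop := forall x, U x ->
  {for x, continuous f} /\
  forall i : 'I_n, derivable f x (delta_mx 0 i : 'rV[R]_n).

Fixpoint Ck_on (k : nat) U f : Prop :=
  C1_on U f /\
  if k is k'.+1 then forall i : 'I_n, Ck_on k' U (partial i f) else True.

Lemma Ck_onP U f : smooth_on U f <-> forall k, Ck_on k U f.
Proof.
split=> [sf k|cf s].
  have : forall s, C1_on U (partials s f) by move=> s x Ux; exact: sf.
  rewrite -[f in Ck_on _ _ f]/(partials [::] f) => c1.
  by elim: k (nil : seq 'I_n) => [|k IH] s; split=> // i; apply: (IH (i :: s)).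
elim/last_ind: s f cf => [|s i IH] f cf x Ux; first by have [c _] := cf 0%N; exact: c.
rewrite /partials -cats1 foldr_cat /=; apply: IH Ux => k.
by have [_ /(_ i)] := cf k.+1.
Qed.

Lemma C1_on_eq U f g : open U -> (forall x, U x -> f x = g x) ->
  C1_on U f -> C1_on U g.
Proof.
move=> oU fg cf x Ux; have [cfx dfx] := cf x Ux.
have nfg : \near x, f x = g x.
  by apply: filterS (open_nbhs_nbhs (conj oU Ux)) => y; exact: fg.
split=> [|i]; last exact: (near_eq_derivable nfg).
have cfg : f @ x --> g x by rewrite -(fg x Ux); exact: cfx.
apply: cvg_trans cfg; apply: near_eq_cvg; [exact: nbhs_filter | exact: nfg].
Qed.

Lemma partial_eq U f g i : open U -> (forall x, U x -> f x = g x) ->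
  forall x, U x -> partial i f x = partial i g x.
Proof.
move=> oU fg x Ux; apply: near_eq_derive.
by apply: filterS (open_nbhs_nbhs (conj oU Ux)) => y; exact: fg.
Qed.

Lemma Ck_on_eq k U f g : open U -> (forall x, U x -> f x = g x) ->
  Ck_on k U f -> Ck_on k U g.
Proof.
move=> oU; elim: k f g => [|k IH] f g fg [c1 ck]; split=> //; do ?exact: C1_on_eq c1.
by move=> i; apply: IH (ck i); exact: partial_eq.
Qed.

Lemma smooth_on_eq U f g : open U -> (forall x, U x -> f x = g x) ->
  smooth_on U f -> smooth_on U g.
Proof. by move=> oU fg /Ck_onP sf; apply/Ck_onP => k; exact: Ck_on_eq (sf k). Qed.

Lemma smooth_onS U V f : U `<=` V -> smooth_on V f -> smooth_on U f.
Proof. by move=> UV sf s x /UV; exact: sf. Qed.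

Lemma Ck_onW k U f : Ck_on k.+1 U f -> Ck_on k U f.
Proof.
elim: k f => [|k IH] f [c1 ck]; split=> // i.
by apply: IH; exact: ck.
Qed.

Lemma Ck_on_cst k U (r : R) : Ck_on k U (cst r).
Proof.
have c1 (t : R) : C1_on U (cst t : 'rV[R]_n -> R).
  by move=> x _; split=> [|i]; [exact: cst_continuous | exact: derivable_cst].
elim: k r => [|k IH] r; split=> // i; rewrite (_ : partial i (cst r) = cst 0) //.
by apply/funext => x; rewrite /partial derive_cst.
Qed.

Lemma C1_onD U f g : C1_on U f -> C1_on U g -> C1_on U (f + g).
Proof.
move=> cf cg x Ux; have [cfx dfx] := cf x Ux; have [cgx dgx] := cg x Ux.
by split=> [|i]; [exact: continuousD | exact: derivableD].
Qed.

Lemma C1_onM U f g : C1_on U f -> C1_on U g -> C1_on U (f * g).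
Proof.
move=> cf cg x Ux; have [cfx dfx] := cf x Ux; have [cgx dgx] := cg x Ux.
by split=> [|i]; [exact: continuousM | exact: derivableM].
Qed.

Lemma Ck_onD k U f g : open U -> Ck_on k U f -> Ck_on k U g ->
  Ck_on k U (f + g).
Proof.
move=> oU; elim: k f g => [|k IH] f g [cf sf] [cg sg]; split.
- exact: C1_onD cf cg.
- exact: I.
- exact: C1_onD cf cg.
- move=> i; apply: Ck_on_eq (IH _ _ (sf i) (sg i)) => // x Ux.
  rewrite /partial deriveD //; [exact: (cf x Ux).2 | exact: (cg x Ux).2].
Qed.

Lemma Ck_onM k U f g : open U -> Ck_on k U f -> Ck_on k U g ->
  Ck_on k U (f * g).
Proof.
move=> oU; elim: k f g => [|k IH] f g.
  by move=> [cf _] [cg _]; split; [exact: C1_onM | exact: I].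
move=> cf cg; have [[c1f sf] [c1g sg]] := (cf, cg).
split=> [|i]; first exact: C1_onM.
apply: (@Ck_on_eq _ _ (f * partial i g + g * partial i f)) ; [exact: oU|move=> x Ux|].
  by rewrite /partial deriveM; [by [] | exact: (c1f x Ux).2 | exact: (c1g x Ux).2].
apply: Ck_onD; first exact: oU.
  by apply: IH; [exact: Ck_onW cf | exact: sg].
by apply: IH; [exact: Ck_onW cg | exact: sf].
Qed.

Lemma smooth_on_cst U (r : R) : smooth_on U (cst r).
Proof. by apply/Ck_onP => k; exact: Ck_on_cst. Qed.

Lemma smooth_onM U f g : open U -> smooth_on U f -> smooth_on U g ->
  smooth_on U (f * g).
Proof.
by move=> oU /Ck_onP sf /Ck_onP sg; apply/Ck_onP => k; exact: Ck_onM.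
Qed.

End SmoothRn.

Section SmoothBlocks.
Variables (R : realType) (n1 n2 : nat).
Implicit Types (f : 'rV[R]_n1 -> R) (h : 'rV[R]_n2 -> R).
Local Notation lsub := (@lsubmx R 1 n1 n2).
Local Notation rsub := (@rsubmx R 1 n1 n2).

Lemma lsub_delta (i : 'I_n1) :
  lsub (delta_mx 0 (lshift n2 i)) = delta_mx 0 i.
Proof. by apply/rowP => j; rewrite !mxE (inj_eq (@lshift_inj _ _)). Qed.

Lemma lsub_delta0 (i : 'I_n2) : lsub (delta_mx 0 (rshift n1 i)) = 0.
Proof. by apply/rowP => j; rewrite !mxE eq_lrshift andbF. Qed.

Lemma rsub_delta (i : 'I_n2) :
  rsub (delta_mx 0 (rshift n1 i)) = delta_mx 0 i.
Proof. by apply/rowP => j; rewrite !mxE (inj_eq (@rshift_inj _ _)). Qed.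

Lemma rsub_delta0 (i : 'I_n1) : rsub (delta_mx 0 (lshift n2 i)) = 0.
Proof. by apply/rowP => j; rewrite !mxE eq_rlshift andbF. Qed.

Lemma quot_lsub f (x v : 'rV[R]_(n1 + n2)) :
  (fun h : R => h^-1 *: (((f \o lsub) \o shift x) (h *: v) - (f \o lsub) x)) =
  (fun h : R => h^-1 *: ((f \o shift (lsub x)) (h *: lsub v) - f (lsub x))).
Proof.
apply/funext => t /=; rewrite (_ : lsub (_ + _) = t *: lsub v + lsub x) //.
by apply/rowP => j; rewrite !mxE.
Qed.

Lemma quot_rsub h (x v : 'rV[R]_(n1 + n2)) :
  (fun t : R => t^-1 *: (((h \o rsub) \o shift x) (t *: v) - (h \o rsub) x)) =
  (fun t : R => t^-1 *: ((h \o shift (rsub x)) (t *: rsub v) - h (rsub x))).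
Proof.
apply/funext => t /=; rewrite (_ : rsub (_ + _) = t *: rsub v + rsub x) //.
by apply/rowP => j; rewrite !mxE.
Qed.

Lemma derive0 n (f : 'rV[R]_n -> R) x : 'D_0 f x = 0.
Proof.
rewrite /derive (_ : (fun _ => _) = cst 0) ?lim_cst//.
by apply/funext => t /=; rewrite scaler0 add0r subrr scaler0.
Qed.

Lemma derivable0v n (f : 'rV[R]_n -> R) x : derivable f x 0.
Proof.
rewrite /derivable (_ : (fun _ => _) = cst 0); first exact: is_cvg_cst.
by apply/funext => t /=; rewrite scaler0 add0r subrr scaler0.
Qed.

Lemma partial_lsub f i :
  partial i (f \o lsub) =
  match fintype.split i with inl i1 => partial i1 f \o lsub | inr _ => cst 0 end.
Proof.
apply/funext => x; rewrite /partial /derive quot_lsub.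
case: (fintype.split i) (fintype.splitK i) => j /= <-.
  by rewrite lsub_delta.
by rewrite lsub_delta0; exact: derive0.
Qed.

Lemma partial_rsub h i :
  partial i (h \o rsub) =
  match fintype.split i with inl _ => cst 0 | inr i2 => partial i2 h \o rsub end.
Proof.
apply/funext => x; rewrite /partial /derive quot_rsub.
case: (fintype.split i) (fintype.splitK i) => j /= <-.
  by rewrite rsub_delta0; exact: derive0.
by rewrite rsub_delta.
Qed.

Lemma C1_on_lsub U f : C1_on U f -> C1_on (lsub @^-1` U) (f \o lsub).
Proof.
move=> c1 x /c1[cx dx]; split=> [|i].
  exact: (continuous_comp (@continuous_lsubmx _ _ _ _ x) cx).
rewrite /derivable quot_lsub; case: (fintype.split i) (fintype.splitK i) => j /= <-.
  by rewrite lsub_delta; exact: dx.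
by rewrite lsub_delta0; exact: derivable0v.
Qed.

Lemma smooth_on_lsub U f : smooth_on U f -> smooth_on (lsub @^-1` U) (f \o lsub).
Proof.
move=> /Ck_onP sf; apply/Ck_onP => k.
elim: k f {sf}(sf k) => [|k IH] f [c1 ck]; (split; first exact: C1_on_lsub).
  exact: I.
move=> i; rewrite partial_lsub; case: (fintype.split i) => j; first exact: IH (ck j).
  exact: Ck_on_cst.
Qed.

Lemma C1_on_rsub U h : C1_on U h -> C1_on (rsub @^-1` U) (h \o rsub).
Proof.
move=> c1 x /c1[cx dx]; split=> [|i].
  exact: (continuous_comp (@continuous_rsubmx _ _ _ _ x) cx).
rewrite /derivable quot_rsub; case: (fintype.split i) (fintype.splitK i) => j /= <-.
  by rewrite rsub_delta0; exact: derivable0v.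
by rewrite rsub_delta; exact: dx.
Qed.

Lemma smooth_on_rsub U h : smooth_on U h -> smooth_on (rsub @^-1` U) (h \o rsub).
Proof.
move=> /Ck_onP sf; apply/Ck_onP => k.
elim: k h {sf}(sf k) => [|k IH] h [c1 ck]; (split; first exact: C1_on_rsub).
  exact: I.
move=> i; rewrite partial_rsub; case: (fintype.split i) => j; last exact: IH (ck j).
  exact: Ck_on_cst.
Qed.

End SmoothBlocks.

Local Obligation Tactic := idtac.

Record chart (R : realType) (n : nat) (T : topologicalType) := Chart {
  dom : set T;
  coord : T -> 'rV[R]_n;
  point : 'rV[R]_n -> T; (* inverse of coord; junk outside coord @` dom *)
  dom_open : open dom;
  img_open : open (coord @` dom);
  coordK : forall p, dom p -> point (coord p) = p;
  coord_cont : forall p, dom p -> {for p, continuous coord};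
  point_cont : forall x, (coord @` dom) x -> {for x, continuous point} }.

Definition img (R : realType) n (T : topologicalType) (c : chart R n T) :
  set 'rV[R]_n := coord c @` dom c.

(* Smooth manifolds of dimension n, given by a smooth atlas (indexed by an    *)
(* arbitrary type) on a Hausdorff second countable space.                     *)
Record manifold (R : realType) (n : nat) := Manifold {
  carrier :> topologicalType;
  idx : Type;
  atlas : idx -> chart R n carrier;
  atlas_cover : forall p : carrier, exists a, dom (atlas a) p;
  atlas_smooth : forall (a b : idx) (j : 'I_n),
    smooth_on (coord (atlas a) @` (dom (atlas a) `&` dom (atlas b)))
      (fun x => coord (atlas b) (point (atlas a) x) 0 j);
  manifold_hausdorff : hausdorff_space carrier;
  manifold_countable : @second_countable carrier }.

Section Fields.
Variables (R : realType) (n : nat) (M : manifold R n).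
Implicit Types (a b : idx M) (p : M) (h : M -> R).

Definition domain a : set M := dom (atlas a).

Definition smooth_in a h : Prop :=
  smooth_on (img (atlas a)) (h \o point (atlas a)).

Definition smooth_fun h : Prop := forall a, smooth_in a h.

(* (d/dx^i) h in the chart a *)
Definition dpart a (i : 'I_n) h : M -> R :=
  fun p => partial i (h \o point (atlas a)) (coord (atlas a) p).

(* (i, j) entry: dy^j / dx^i, with x the chart a and y the chart b *)
Definition jac a b p : 'M[R]_n :=
  \matrix_(i, j) dpart a i (fun q => coord (atlas b) q 0 j) p.

Record pos_fun := PosFun {
  pos_val :> M -> R;
  pos_smooth : smooth_fun pos_val;
  pos_gt0 : forall p, 0 < pos_val p }.

(* Tensor fields are families of components, one for each chart (constrained  *)
(* on the domain of the chart only), obeying the usual transformation law.    *)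
Record metric := Metric {
  metric_comp :> idx M -> M -> 'M[R]_n;
  metric_sym : forall a p, domain a p -> (metric_comp a p)^T = metric_comp a p;
  metric_nondeg : forall a p, domain a p -> metric_comp a p \in unitmx;
  metric_smooth : forall a i j, smooth_in a (fun p => metric_comp a p i j);
  metric_trans : forall a b p, domain a p -> domain b p ->
    metric_comp a p = jac a b p *m metric_comp b p *m (jac a b p)^T }.

Record vector_field := VectorField {
  vf_comp :> idx M -> M -> 'rV[R]_n;
  vf_smooth : forall a i, smooth_in a (fun p => vf_comp a p 0 i);
  vf_trans : forall a b p, domain a p -> domain b p ->
    vf_comp b p = vf_comp a p *m jac a b p }.

Implicit Types (g : metric) (Z : vector_field).

(* Christoffel symbol Gamma^k_ij of the Levi-Civita connection *)
Definition christoffel g a (k i j : 'I_n) p : R :=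
  2^-1 * \sum_l invmx (g a p) k l *
    (dpart a i (fun q => g a q j l) p + dpart a j (fun q => g a q i l) p
     - dpart a l (fun q => g a q i j) p).

(* R(d_i, d_j) d_k = sum_l (riemann l k i j) d_l with                         *)
(* R(X, Y) = [nabla_X, nabla_Y] - nabla_[X, Y]                                *)
Definition riemann g a (l k i j : 'I_n) p : R :=
  dpart a i (christoffel g a l j k) p - dpart a j (christoffel g a l i k) p
  + \sum_m (christoffel g a l i m p * christoffel g a m j k p
            - christoffel g a l j m p * christoffel g a m i k p).

(* Ric(Y, Z) = trace of X |-> R(X, Y) Z *)
Definition ricci g a p : 'M[R]_n :=
  \matrix_(j, k) \sum_i riemann g a i k i j p.

Definition scalar_curvature g a p : R := \tr (invmx (g a p) *m ricci g a p).

Definition lie_metric Z g a p : 'M[R]_n :=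
  \matrix_(i, j) \sum_k (Z a p 0 k * dpart a k (fun q => g a q i j) p
    + g a p k j * dpart a i (fun q => Z a q 0 k) p
    + g a p i k * dpart a j (fun q => Z a q 0 k) p).

(* Equations between tensor fields are required in every chart. *)
Definition almost_rb_soliton g Z (lam : M -> R) (rho : R) : Prop :=
  smooth_fun lam /\
  forall a p, domain a p ->
    ricci g a p + 2^-1 *: lie_metric Z g a p
    = (lam p + rho * scalar_curvature g a p) *: g a p.

Definition homothetic g Z (c : R) : Prop :=
  forall a p, domain a p -> lie_metric Z g a p = (2 * c) *: g a p.

Definition einstein_with g (mu : R) : Prop :=
  forall a p, domain a p -> ricci g a p = mu *: g a p.

Lemma trmxZ (m k : nat) (r : R) (A : 'M[R]_(m, k)) : (r *: A)^T = r *: A^T.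
Proof. by apply/matrixP => i j; rewrite !mxE. Qed.

Program Definition conformal (phi : pos_fun) g : metric :=
  @Metric (fun a p => phi p ^+ 2 *: g a p) _ _ _ _.
Next Obligation. by move=> phi g a p ap /=; rewrite trmxZ metric_sym.  Qed.
Next Obligation.
move=> phi g a p ap /=.
by rewrite unitmxZ ?metric_nondeg// unitfE expf_neq0// gt_eqF// pos_gt0.
Qed.
Next Obligation.
move=> phi g a i j /=; rewrite /smooth_in.
set u := phi \o point (atlas a).
apply: (@smooth_on_eq _ _ _ (u * u * ((fun p => g a p i j) \o point (atlas a)))).
- exact: img_open.
- by move=> x _; rewrite /= mxE expr2.
- have su : smooth_on (img (atlas a)) u by exact: pos_smooth.
  apply: smooth_onM; [exact: img_open| |exact: metric_smooth].
  by apply: smooth_onM => //; exact: img_open.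
Qed.
Next Obligation.
move=> phi g a b p ap bp /=.
by rewrite (metric_trans g ap bp) -scalemxAr -scalemxAl.
Qed.

End Fields.

Section Product.
Variables (R : realType) (n1 n2 : nat).

Section ProductChart.
Variables (T1 T2 : topologicalType) (c1 : chart R n1 T1) (c2 : chart R n2 T2).

Definition prod_dom : set (T1 * T2) := dom c1 `*` dom c2.
Definition prod_coord (p : T1 * T2) : 'rV[R]_(n1 + n2) :=
  row_mx (coord c1 p.1) (coord c2 p.2).
Definition prod_point (x : 'rV[R]_(n1 + n2)) : T1 * T2 :=
  (point c1 (lsubmx x), point c2 (rsubmx x)).

Lemma prod_imgE : prod_coord @` prod_dom =
  (lsubmx @^-1` img c1) `&` (rsubmx @^-1` img c2).
Proof.
apply/seteqP; split=> [x [[p q] [/= dp dq] <-]|x [[p dp px] [q dq qx]]].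
  by split; rewrite /prod_coord /= (row_mxKl, row_mxKr); [exists p | exists q].
by exists (p, q) => //; rewrite /prod_coord /= px qx hsubmxK.
Qed.

Program Definition prod_chart : chart R (n1 + n2) (T1 * T2)%type :=
  @Chart R (n1 + n2) (T1 * T2)%type prod_dom prod_coord prod_point _ _ _ _ _.
Next Obligation.
rewrite openE => -[p q] [/= dp dq]; exists (dom c1, dom c2) => //=.
by split; apply: open_nbhs_nbhs; split=> //; exact: dom_open.
Qed.
Next Obligation.
rewrite prod_imgE; apply: openI; apply: open_comp; try exact: img_open.
  by move=> x _; exact: continuous_lsubmx.
by move=> x _; exact: continuous_rsubmx.
Qed.
Next Obligation.
move=> [p q] [/= dp dq]; rewrite /prod_point /prod_coord /=.
by rewrite row_mxKl row_mxKr !coordK.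
Qed.
Next Obligation.
move=> [p q] [/= dp dq] A [P nP sPA].
have [N1 N1p N1P] : exists2 N, nbhs p N & forall y, N y ->
    forall j, P 0 (lshift n2 j) (coord c1 y 0 j).
  exists (coord c1 @^-1` [set m | forall i j, P i (lshift n2 j) (m i j)]).
    apply: (coord_cont dp); exists (fun i j => P i (lshift n2 j)) => //= i j.
    by have := nP i (lshift n2 j); rewrite /prod_coord row_mxEl.
  by move=> y /= h j.
have [N2 N2q N2P] : exists2 N, nbhs q N & forall y, N y ->
    forall j, P 0 (rshift n1 j) (coord c2 y 0 j).
  exists (coord c2 @^-1` [set m | forall i j, P i (rshift n1 j) (m i j)]).
    apply: (coord_cont dq); exists (fun i j => P i (rshift n1 j)) => //= i j.
    by have := nP i (rshift n1 j); rewrite /prod_coord row_mxEr.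
  by move=> y /= h j.
exists (N1, N2) => //= -[y z] [/= /N1P hy /N2P hz]; apply: sPA => i j.
rewrite /prod_coord /= ord1; case: (fintype.split j) (fintype.splitK j) => k /= <-.
  by rewrite row_mxEl.
by rewrite row_mxEr.
Qed.
Next Obligation.
move=> x; rewrite prod_imgE => -[/= ix iy].
have l : {for x, continuous (point c1 \o lsubmx)}.
  apply: continuous_comp; first exact: continuous_lsubmx.
  exact: point_cont.
have r : {for x, continuous (point c2 \o rsubmx)}.
  apply: continuous_comp; first exact: continuous_rsubmx.
  exact: point_cont.
exact: cvg_pair l r.
Qed.

End ProductChart.

Lemma hausdorff_pair (T1 T2 : topologicalType) :
  hausdorff_space T1 -> hausdorff_space T2 -> hausdorff_space (T1 * T2)%type.
Proof.
move=> h1 h2 [p1 p2] [q1 q2] cl; congr pair.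
  apply: h1 => A B nA nB.
  have [] := cl (A `*` setT) (B `*` setT).
  - by exists (A, setT) => //=; split=> //; exact: filterT.
  - by exists (B, setT) => //=; split=> //; exact: filterT.
  by move=> [x y] [[/= Ax _] [/= Bx _]]; exists x.
apply: h2 => A B nA nB.
have [] := cl (setT `*` A) (setT `*` B).
- by exists (setT, A) => //=; split=> //; exact: filterT.
- by exists (setT, B) => //=; split=> //; exact: filterT.
by move=> [x y] [[/= _ Ay] [/= _ By]]; exists y.
Qed.

Lemma second_countable_pair (T1 T2 : topologicalType) :
  @second_countable T1 -> @second_countable T2 ->
  @second_countable (T1 * T2)%type.
Proof.
move=> [B1 cB1 [oB1 fB1]] [B2 cB2 [oB2 fB2]].
exists ((fun UV => UV.1 `*` UV.2) @` (B1 `*` B2)).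
  exact: sub_countable (card_image_le _ _) (countableX cB1 cB2).
split.
  move=> _ [[U V] [/= BU BV] <-]; rewrite openE => -[x y] [/= Ux Vy].
  exists (U, V) => //=.
  by split; apply: open_nbhs_nbhs; split=> //; [exact: oB1 | exact: oB2].
move=> [x y] A [[P Q] [/= nP nQ] sA].
have [U [BU Ux] UP] := fB1 x P nP; have [V [BV Vy] VQ] := fB2 y Q nQ.
exists (U `*` V); first by split=> //; exists (U, V).
by move=> [u v] [/= /UP Pu /VQ Qv]; exact: sA.
Qed.

Variables (M1 : manifold R n1) (M2 : manifold R n2).

Program Definition prod_manifold : manifold R (n1 + n2) :=
  @Manifold R (n1 + n2) (M1 * M2)%type (idx M1 * idx M2)%type
    (fun a => prod_chart (atlas a.1) (atlas a.2)) _ _ _ _.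
Next Obligation.
move=> [p q]; have [a ap] := atlas_cover p; have [b bq] := atlas_cover q.
by exists (a, b).
Qed.
Next Obligation.
move=> [a1 a2] [b1 b2] j; rewrite /= /prod_coord /=.
case: (fintype.split j) (fintype.splitK j) => k /= <-.
  rewrite (_ : (fun _ => _) =
    (fun x => coord (atlas b1) (point (atlas a1) x) 0 k) \o lsubmx); last first.
    by apply/funext => x /=; rewrite row_mxEl.
  apply: (smooth_onS _ (smooth_on_lsub (@atlas_smooth _ _ M1 a1 b1 k))).
  move=> _ [[p q] [[/= a1p a2q] [/= b1p b2q]] <-] /=; exists p => //.
  by rewrite row_mxKl.
rewrite (_ : (fun _ => _) =
  (fun x => coord (atlas b2) (point (atlas a2) x) 0 k) \o rsubmx); last first.
  by apply/funext => x /=; rewrite row_mxEr.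
apply: (smooth_onS _ (smooth_on_rsub (@atlas_smooth _ _ M2 a2 b2 k))).
move=> _ [[p q] [[/= a1p a2q] [/= b1p b2q]] <-] /=; exists q => //.
by rewrite row_mxKr.
Qed.
Next Obligation. by apply: hausdorff_pair; exact: manifold_hausdorff. Qed.
Next Obligation. by apply: second_countable_pair; exact: manifold_countable. Qed.

Lemma jac_prod (a b : idx prod_manifold) (p : prod_manifold) :
  jac a b p = block_mx (jac a.1 b.1 p.1) 0 0 (jac a.2 b.2 p.2).
Proof.
have cl k : (fun q : prod_manifold => coord (atlas b) q 0 (lshift n2 k))
    \o point (atlas a) =
    ((fun q => coord (atlas b.1) q 0 k) \o point (atlas a.1)) \o lsubmx.
  by apply/funext => x /=; rewrite /prod_coord row_mxEl.
have cr k : (fun q : prod_manifold => coord (atlas b) q 0 (rshift n1 k))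
    \o point (atlas a) =
    ((fun q => coord (atlas b.2) q 0 k) \o point (atlas a.2)) \o rsubmx.
  by apply/funext => x /=; rewrite /prod_coord row_mxEr.
apply/matrixP => i j; rewrite !mxE /dpart.
case: (fintype.split j) (fintype.splitK j) => l /= <-.
  rewrite cl partial_lsub.
  case: (fintype.split i) => k /=; rewrite !mxE ?(unsplitK (inl _)) ?mxE//.
  by rewrite /dpart /= /prod_coord row_mxKl.
rewrite cr partial_rsub.
case: (fintype.split i) => k /=; rewrite !mxE ?(unsplitK (inr _)) ?mxE//.
by rewrite /dpart /= /prod_coord row_mxKr.
Qed.

Program Definition twisted (g1 : metric M1) (g2 : metric M2)
    (f : pos_fun prod_manifold) : metric prod_manifold :=
  @Metric R (n1 + n2) prod_manifold
    (fun a p => block_mx (g1 a.1 p.1) 0 0 (f p ^+ 2 *: g2 a.2 p.2)) _ _ _ _.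
Next Obligation.
move=> g1 g2 f a p [/= d1 d2].
by rewrite tr_block_mx !trmx0 trmxZ !metric_sym.
Qed.
Next Obligation.
move=> g1 g2 f a p [/= d1 d2].
rewrite unitmxE det_ublock unitrM -!unitmxE metric_nondeg//=.
by rewrite unitmxZ ?metric_nondeg// unitfE expf_neq0// gt_eqF// pos_gt0.
Qed.
Next Obligation.
move=> g1 g2 f [a1 a2] i j; rewrite /smooth_in.
set D := img _; have oD : open D by exact: img_open.
have Dl : D `<=` lsubmx @^-1` img (atlas a1).
  by rewrite /D /img /= prod_imgE => x [].
have Dr : D `<=` rsubmx @^-1` img (atlas a2).
  by rewrite /D /img /= prod_imgE => x [].
have s0 : smooth_on D (cst 0 : 'rV[R]_(n1 + n2) -> R) by exact: smooth_on_cst.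
case: (fintype.split i) (fintype.splitK i) => k /= <-;
  case: (fintype.split j) (fintype.splitK j) => l /= <-.
- have := smooth_onS Dl (smooth_on_lsub (@metric_smooth _ _ _ g1 a1 k l)).
  by apply: smooth_on_eq => // x _; rewrite /= block_mxEul.
- by apply: (smooth_on_eq oD _ s0) => x _; rewrite /= block_mxEur mxE.
- by apply: (smooth_on_eq oD _ s0) => x _; rewrite /= block_mxEdl mxE.
- have sg := smooth_onS Dr (smooth_on_rsub (@metric_smooth _ _ _ g2 a2 k l)).
  have sf : smooth_on D (f \o prod_point (atlas a1) (atlas a2)).
    exact: (@pos_smooth _ _ _ f (a1, a2)).
  have := smooth_onM oD (smooth_onM oD sf sf) sg.
  by apply: smooth_on_eq => // x _; rewrite /= block_mxEdr mxE expr2.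
Qed.
Next Obligation.
move=> g1 g2 f a b p [/= d1 d2] [/= e1 e2].
rewrite jac_prod tr_block_mx !trmx0 !mulmx_block.
rewrite !(mul0mx, mulmx0, addr0, add0r) /=.
by rewrite (metric_trans g1 d1 e1) (metric_trans g2 d2 e2) -scalemxAr -scalemxAl.
Qed.

End Product.

(* g_L = phi^2 (g1 (+) f^2 g2) *)
Definition lyra_metric (R : realType) (n1 n2 : nat)
    (M1 : manifold R n1) (M2 : manifold R n2) (g1 : metric M1) (g2 : metric M2)
    (f phi : pos_fun (prod_manifold M1 M2)) : metric (prod_manifold M1 M2) :=
  conformal phi (twisted g1 g2 f).

(* Main.v *)
From HB Require Import structures.
Require Import Defs.
From mathcomp Require Import all_boot all_order all_algebra.
From mathcomp Require Import all_classical all_reals all_analysis.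
From mathcomp Require Import ring lra.
Set Implicit Arguments.
Unset Strict Implicit.
Unset Printing Implicit Defensive.
Import Order.TTheory GRing.Theory Num.Theory.
Import numFieldNormedType.Exports.
Local Open Scope classical_set_scope.
Local Open Scope ring_scope.

(* Since Z is homothetic, the soliton equation says Ric = h g at each point, so
   the content is Schur's lemma. In a chart, let A_i be the matrices of
   Christoffel symbols; their curvature F_ij satisfies the second Bianchi identity
   and is skew with respect to g. Contracting the cyclic sum of nabla_m F_ij twice
   gives (n - 2) d_m h = 0, hence h is locally constant.

   The scalar curvature is defined chart by chart, and for rho = 1/n the soliton
   equation does not determine h, so gluing the local constants needs the
   transformation law of the Ricci tensor. It follows from the uniqueness of the
   metric torsion free connection: with P the transposed Jacobian and B_i the
   pulled back connection, P A_i = B_i P + d_i P, whose curvature is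
   P F(A) = F(B) P. *)

(** * Partial derivatives *)

(** Smoothness is phrased through iterated partial derivatives alone, so the symmetry of mixed
    partials, the chain rule and local constancy all come from the one-variable mean value theorem
    along coordinate directions. Writing the connection as matrices A_i confines the analysis to
    product rules and commuting partials; what remains of each curvature identity is noncommutative
    algebra. In n - 2, the n is the trace of g^-1 g, and each of the two other terms of the cyclic
    sum contributes -1: one through the skewness of the curvature with respect to g, the other
    through its antisymmetry in the form slots. The factor h is given only pointwise and chart by
    chart; its smoothness is recovered from the entries of g^-1 Ric. *)

Section PartialDerivatives.
Context {R : realType} {n : nat}.
Implicit Types (f g : 'rV[R]_n -> R) (U : set 'rV[R]_n) (x v : 'rV[R]_n).
Local Notation e i := (delta_mx 0 i : 'rV[R]_n).

Lemma is_derive_line f x v (t : R) : derivable f (x + t *: v) v ->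
  is_derive t 1 (fun s : R => f (x + s *: v)) ('D_v f (x + t *: v)).
Proof.
have E : (fun h : R => h^-1 *: (((fun s : R => f (x + s *: v)) \o shift t) (h *: 1)
     - f (x + t *: v))) =
    (fun h : R => h^-1 *: ((f \o shift (x + t *: v)) (h *: v) - f (x + t *: v))).
  apply/funext => h /=; congr (_ *: (f _ - _)).
  by rewrite [h *: 1]mulr1 scalerDl addrCA.
by move=> df; apply: DeriveDef; rewrite /derivable /derive E.
Qed.

Lemma MVT_line f x v (b : R) : 0 < b ->
  (forall t, 0 <= t <= b -> derivable f (x + t *: v) v) ->
  exists2 t, 0 <= t <= b & f (x + b *: v) - f x = b * 'D_v f (x + t *: v).
Proof.
move=> b0 df.
have dl t : t \in `[0, b]%R ->
    is_derive t 1 (fun s : R => f (x + s *: v)) ('D_v f (x + t *: v)).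
  by rewrite in_itv => /df; exact: is_derive_line.
pose g (t : R) := f (x + t *: v); pose dg (t : R) := 'D_v f (x + t *: v).
have gd t : t \in `]0, b[%R -> is_derive t 1 g (dg t).
  by move=> tb; apply: dl; exact: subset_itv_oo_cc tb.
have gc : {within `[0, b], continuous g}.
  by apply: derivable_within_continuous => t /dl[].
have [t tb E] := MVT_segment (ltW b0) gd gc.
exists t; first by rewrite in_itv in tb.
by move: E; rewrite /g scale0r addr0 subr0 mulrC.
Qed.

Lemma is_derive_translate f x v w : derivable f (x + w) v ->
  is_derive x v (fun y => f (y + w)) ('D_v f (x + w)).
Proof.
have E : (fun h : R => h^-1 *: (((fun y => f (y + w)) \o shift x) (h *: v)
     - f (x + w))) =
    (fun h : R => h^-1 *: ((f \o shift (x + w)) (h *: v) - f (x + w))).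
  by apply/funext => h /=; congr (_ *: (f _ - _)); rewrite addrA.
by move=> df; apply: DeriveDef; rewrite /derivable /derive E.
Qed.

(* Two applications of the mean value theorem to the second difference of f. *)
Lemma second_difference U f x (i j : 'I_n) (h : R) : 0 < h ->
  C1_on U f -> C1_on U (partial i f) ->
  (forall s t, 0 <= s <= h -> 0 <= t <= h -> U (x + s *: e i + t *: e j)) ->
  exists s t, [/\ 0 <= s <= h, 0 <= t <= h &
    f (x + h *: e i + h *: e j) - f (x + h *: e i) - (f (x + h *: e j) - f x)
    = h * (h * partial j (partial i f) (x + s *: e i + t *: e j))].
Proof.
move=> h0 cf cif Uh; have hh : 0 <= h <= h by rewrite lexx ltW.
have h00 : 0 <= (0 : R) <= h by rewrite lexx ltW.
pose g y := f (y + h *: e j) - f y.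
have Us s : 0 <= s <= h -> U (x + s *: e i) /\ U (x + s *: e i + h *: e j).
  move=> sh; split; last exact: Uh.
  by have := Uh s 0 sh h00; rewrite scale0r addr0.
have dg s : 0 <= s <= h -> is_derive (x + s *: e i) (e i) g
    (partial i f (x + s *: e i + h *: e j) - partial i f (x + s *: e i)).
  move=> /Us[U1 U2]; apply: is_deriveB.
    by apply: is_derive_translate; exact: (cf _ U2).2.
  by apply: DeriveDef => //; exact: (cf _ U1).2.
have [t /dg[]//|s sh Es] := @MVT_line g x (e i) h h0.
have [|t th Et] := @MVT_line (partial i f) (x + s *: e i) (e j) h h0.
  by move=> t th; have [_] := cif _ (Uh s t sh th).
exists s, t; split; [exact: sh|exact: th|]; rewrite -[_ - _ - _]/(g (x + h *: e i) - g x) Es.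
by have [_ ->] := dg _ sh; rewrite Et.
Qed.

(** The second difference over a small parallelogram is unchanged when [i] and [j] trade places.
    Hence the two mixed partials, each at some point of the parallelogram, take a common value, and
    continuity at [x] finishes. *)
Lemma partialC U f (i j : 'I_n) x : open U -> smooth_on U f -> U x ->
  partial j (partial i f) x = partial i (partial j f) x.
Proof.
move=> oU sf Ux.
have c1 s : C1_on U (partials s f) by move=> y; exact: sf.
set d := partial j (partial i f); set d' := partial i (partial j f).
apply/eqP; rewrite -subr_eq0 -normr_le0; apply/ler_addgt0Pr => /= eps eps0.
rewrite add0r.
have near_x (k : 'rV[R]_n -> R) : {for x, continuous k} ->
    \forall y \near x, `|k x - k y| < eps / 2.
  by move=> ck; apply: (@cvgr_dist_lt _ _ _ _ _ k (k x) ck); rewrite divr_gt0.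
have nU : nbhs x U by exact: open_nbhs_nbhs.
have nd : \forall y \near x, `|d x - d y| < eps / 2.
  by apply: near_x; exact: (sf [:: j; i] x Ux).1.
have nd' : \forall y \near x, `|d' x - d' y| < eps / 2.
  by apply: near_x; exact: (sf [:: i; j] x Ux).1.
have [r r0 br] := (nbhs_normP _ _).1 (filterI nU (filterI nd nd')).
(* The side [h] is chosen so that the whole parallelogram lies in the ball of radius [r]; the
   summand 1 makes the denominator positive and the bound strict. *)
have c0 : 0 < `|e i| + `|e j| + 1 by rewrite ltr_wpDl// addr_ge0.
set h := r / (`|e i| + `|e j| + 1); have h0 : 0 < h by rewrite divr_gt0.
have near s t : 0 <= s <= h -> 0 <= t <= h ->
    [/\ U (x + s *: e i + t *: e j), `|d x - d (x + s *: e i + t *: e j)| < eps / 2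
     & `|d' x - d' (x + s *: e i + t *: e j)| < eps / 2].
  move=> /andP[s0 sh] /andP[t0 th].
  suff /br[? []] : ball_ Num.Def.normr x r (x + s *: e i + t *: e j) by [].
  rewrite /= -addrA opprD addNKr normrN.
  apply: le_lt_trans (ler_normD _ _) _; rewrite !normrZ !ger0_norm//.
  apply: (@le_lt_trans _ _ (h * (`|e i| + `|e j|))).
    by rewrite mulrDr lerD// ler_wpM2r.
  by rewrite /h mulrAC ltr_pdivrMr// ltr_pM2l// ltrDl.
have Uh s t (sh : 0 <= s <= h) (th : 0 <= t <= h) := let: And3 u _ _ := near s t sh th in u.
have [s [t [sh th E]]] :=
  second_difference h0 (c1 [::]) (c1 [:: i]) Uh.
have [s' [t' [sh' th' E']]] : exists s t, [/\ 0 <= s <= h, 0 <= t <= h &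
    f (x + h *: e i + h *: e j) - f (x + h *: e i) - (f (x + h *: e j) - f x)
    = h * (h * d' (x + s *: e i + t *: e j))].
  have Uh' u w (uh : 0 <= u <= h) (wh : 0 <= w <= h) : U (x + u *: e j + w *: e i).
    by rewrite addrAC; exact: Uh.
  have [s' [t' [sh' th' E']]] :=
    second_difference h0 (c1 [::]) (c1 [:: j]) Uh'.
  exists t', s'; split; [exact: th'|exact: sh'|].
  rewrite [x + t' *: _ + _]addrAC -E' [x + h *: e j + _]addrAC.
  rewrite /=; move: (f (x + _ + _)) (f (x + h *: e i)) (f (x + h *: e j)) (f x) => p q q' w.
  by ring.
have hn0 : h != 0 by rewrite gt_eqF.
have {E' E} Ed : d (x + s *: e i + t *: e j) = d' (x + s' *: e i + t' *: e j).
  by apply: (mulfI hn0); apply: (mulfI hn0); exact: etrans (esym E) E'.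
have [_ l1 _] := near s t sh th; have [_ _ l2] := near s' t' sh' th'.
rewrite -Ed distrC in l2; move: (d x) (d' x) (d (_ + _)) l1 l2 => a b m l1 l2.
rewrite (_ : a - b = (a - m) + (m - b)); last by ring.
apply: le_trans (ler_normD _ _) _; apply: ltW.
by have := ltrD l1 l2; rewrite -splitr.
Qed.

(** Coordinate increments may have either sign. For negative [b] the segment is traversed from its
    other end [x + b *: v]. *)
Lemma MVT_line_signed f x v (b : R) :
  (forall t, `|t| <= `|b| -> derivable f (x + t *: v) v) ->
  exists2 t, `|t| <= `|b| & f (x + b *: v) - f x = b * 'D_v f (x + t *: v).
Proof.
move=> df; have [b0|b0|->] := ltrgt0P b; last first.
- by exists 0; rewrite ?normr0 // scale0r addr0 subrr mul0r.
- have b'0 : 0 < - b by rewrite oppr_gt0.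
  have tb t : 0 <= t <= - b -> `|b + t| <= - b.
    by move=> /andP[t0 tb]; rewrite ler0_norm; lra.
  have xb t : x + b *: v + t *: v = x + (b + t) *: v by rewrite scalerDl addrA.
  have bb : `|b| = - b by rewrite ltr0_norm.
  have d' t : 0 <= t <= - b -> derivable f (x + b *: v + t *: v) v.
    by move=> /tb; rewrite xb -bb; exact: df.
  have [t t_b E] := MVT_line b'0 d'.
  exists (b + t); first exact: tb.
  by move: E; rewrite !xb subrr scale0r addr0 mulNr => /eqP; rewrite -opprB eqr_opp => /eqP.
have bb : `|b| = b by rewrite gtr0_norm.
have tb t : 0 <= t <= b -> `|t| <= b by move=> /andP[t0 tb]; rewrite ger0_norm.
have d' t : 0 <= t <= b -> derivable f (x + t *: v) v.
  by move=> /tb; rewrite -{1}bb; exact: df.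
have [t t_b E] := MVT_line b0 d'.
by exists t => //; exact: tb.
Qed.

(* Mean value theorem along the path changing one coordinate at a time. *)
Lemma mean_value_path f (y z : 'rV[R]_n) :
  (forall w : 'rV[R]_n, (forall j, `|w 0 j - y 0 j| <= `|z 0 j - y 0 j|) ->
     forall i, derivable f w (e i)) ->
  exists2 xi : 'I_n -> 'rV[R]_n,
    forall k j, `|xi k 0 j - y 0 j| <= `|z 0 j - y 0 j| &
    f z - f y = \sum_k (z 0 k - y 0 k) * partial k f (xi k).
Proof.
move=> df.
pose w k : 'rV[R]_n := \row_j (if (j < k)%N then z 0 j else y 0 j).
have w0 : w 0%N = y by apply/rowP => j; rewrite mxE.
have wn : w n = z by apply/rowP => j; rewrite mxE ltn_ord.
have wS (k : 'I_n) : w k.+1 = w k + (z 0 k - y 0 k) *: e k.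
  apply/rowP => j; rewrite !mxE eqxx/= -(inj_eq val_inj) /= ltnS leq_eqVlt.
  case: eqVneq => [jk|_] /=; last by rewrite mulr0 addr0.
  have -> : j = k by apply: val_inj.
  by rewrite /= ltnn mulr1 subrKC.
have near_y (k : 'I_n) t : `|t| <= `|z 0 k - y 0 k| ->
    forall j, `|(w k + t *: e k) 0 j - y 0 j| <= `|z 0 j - y 0 j|.
  move=> tk j; rewrite !mxE eqxx /= -(inj_eq val_inj) /=.
  case: eqVneq => [jk|_] /=.
    have -> : j = k by apply: val_inj.
    by rewrite ltnn mulr1 addrAC subrr add0r.
  by rewrite mulr0 addr0; case: ifP => // _; rewrite subrr normr0.
have step (k : 'I_n) : exists u : 'rV[R]_n,
    (forall j, `|u 0 j - y 0 j| <= `|z 0 j - y 0 j|) /\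
    f (w k.+1) - f (w k) = (z 0 k - y 0 k) * partial k f u.
  have d' t : `|t| <= `|z 0 k - y 0 k| -> derivable f (w k + t *: e k) (e k).
    by move=> tk; apply: df; exact: near_y.
  have [t tk E] := MVT_line_signed d'.
  by exists (w k + t *: e k); rewrite wS; split=> //; exact: near_y.
have [xi xiP] := choice step.
exists xi => [k j|]; first exact: (xiP k).1.
rewrite -[in f z]wn -[in f y]w0 -(telescope_sumr (fun k => f (w k)) (leq0n n)) big_mkord.
by apply: eq_bigr => k _; exact: (xiP k).2.
Qed.

(** Balls of row vectors are cubes, so a ball inside [U] contains the whole box where
    [mean_value_path] places its intermediate points. *)
Lemma locally_constant U f x : open U -> C1_on U f ->
  (forall i y, U y -> partial i f y = 0) -> U x ->
  \forall y \near x, f y = f x.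
Proof.
move=> oU cf f0 Ux.
have [r r0 br] := (nbhs_ballP _ _).1 (open_nbhs_nbhs (conj oU Ux)).
apply/nbhs_ballP; exists r => // z [_ xz].
have near_x (w : 'rV[R]_n) : (forall j, `|w 0 j - x 0 j| <= `|z 0 j - x 0 j|) -> U w.
  move=> wz; apply: br; split=> // i j; rewrite (ord1 i) -ball_normE /= distrC.
  apply: le_lt_trans (wz j) _; rewrite distrC; exact: xz.
have [w /near_x/cf[]//|xi /(_ _)/near_x Uxi E] := @mean_value_path f x z.
apply/eqP; rewrite -subr_eq0 E big1 // => k _.
by rewrite f0 ?mulr0.
Qed.

Lemma smooth_onD U f g : open U -> smooth_on U f -> smooth_on U g ->
  smooth_on U (f + g).
Proof.
by move=> oU /Ck_onP sf /Ck_onP sg; apply/Ck_onP => k; exact: Ck_onD.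
Qed.

Lemma smooth_on_partial U f i : smooth_on U f -> smooth_on U (partial i f).
Proof.
by move=> /Ck_onP sf; apply/Ck_onP => k; have [_ /(_ i)] := sf k.+1.
Qed.

Lemma smooth_on_sum U (I : Type) (s : seq I) (F : I -> 'rV[R]_n -> R) : open U ->
  (forall i, smooth_on U (F i)) -> smooth_on U (fun x => \sum_(i <- s) F i x).
Proof.
move=> oU sF; elim: s => [|i s IH].

  by apply: (smooth_on_eq oU _ (@smooth_on_cst _ _ _ 0)) => x _; rewrite big_nil.
by apply: (smooth_on_eq oU _ (smooth_onD oU (sF i) IH)) => x _; rewrite big_cons.
Qed.

Lemma smooth_on_prod U (I : Type) (s : seq I) (F : I -> 'rV[R]_n -> R) : open U ->
  (forall i, smooth_on U (F i)) -> smooth_on U (fun x => \prod_(i <- s) F i x).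
Proof.
move=> oU sF; elim: s => [|i s IH].
  by apply: (smooth_on_eq oU _ (@smooth_on_cst _ _ _ 1)) => x _; rewrite big_nil.
by apply: (smooth_on_eq oU _ (smooth_onM oU (sF i) IH)) => x _; rewrite big_cons.
Qed.

(** The derivative of 1/f is -(1/f)^2 times that of f, so 1/f being C^k gives C^(k+1): the induction
    feeds on its own conclusion. *)
Lemma smooth_onV U f : open U -> (forall x, U x -> f x != 0) ->
  smooth_on U f -> smooth_on U (fun x => (f x)^-1).
Proof.
move=> oU f0 sf; pose g x := (f x)^-1.
have c1 : C1_on U g.
  move=> x Ux; have [cx dx] := sf [::] x Ux; split=> [|i].
    by apply: (@continuousV _ _ f) => //; exact: f0.
  by apply: derivableV; [exact: f0 | exact: dx].
apply/Ck_onP; elim=> [|k IH]; split=> // i.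
have ck := (Ck_onP _ _).1 (smooth_on_partial i sf) k.
apply: (@Ck_on_eq _ _ _ _ (cst (-1) * (g * g) * partial i f)) => //.
  move=> x Ux; rewrite /partial deriveV ?f0//; last exact: (sf [::] x Ux).2.
  by rewrite /g /= -exprVn expr2 mulN1r.
apply: (Ck_onM oU _ ck); apply: (Ck_onM oU); first exact: Ck_on_cst.
exact: (Ck_onM oU IH IH).
Qed.

End PartialDerivatives.

(** * The chain rule from continuous partial derivatives *)

Section ChainRule.
Context {R : realType} {m n : nat}.

(** [mean_value_path] turns the difference quotient of [f \o tau] into a sum of quotients of the
    coordinates of [tau] times partials of [f] at intermediate points. These points tend to [tau x],
    where the partials are continuous. *)
Lemma is_derive_comp_coords (W : set 'rV[R]_n) (f : 'rV[R]_n -> R)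
    (tau : 'rV[R]_m -> 'rV[R]_n) (x v : 'rV[R]_m) :
  open W -> smooth_on W f -> W (tau x) ->
  (forall j, {for x, continuous (fun y => tau y 0 j)}) ->
  (forall j, derivable (fun y => tau y 0 j) x v) ->
  is_derive x v (f \o tau)
    (\sum_k 'D_v (fun y => tau y 0 k) x * partial k f (tau x)).
Proof.
move=> oW sf Wx ct dt; have cf : C1_on W f := sf [::].
have [r r0 br] := (nbhs_ballP _ _).1 (open_nbhs_nbhs (conj oW Wx)).
pose g (h : R) := tau (h *: v + x).
have lin : (fun h : R => h *: v + x) @ 0^' --> x.
  rewrite -[X in _ --> X]add0r -(scale0r v).
  apply: cvgD; last exact: cvg_cst.
  by apply: cvgZr_tmp; exact: cvg_within_filter cvg_id.
have g_cvg j : (fun h => g h 0 j) @ 0^' --> tau x 0 j.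
  exact: cvg_comp lin (ct j).
have g_near (d : R) : 0 < d -> \forall h \near 0^', forall j, `|g h 0 j - tau x 0 j| < d.
  move=> d0; apply: filter_forall => j.
  by move/cvgrPdistC_lt: (g_cvg j); apply.
(* The bound on [g h] sits inside the existential so that [choice] yields intermediate points for
   every [h]; far from 0 they are the junk value 0. *)
have mean h : exists xi : 'I_n -> 'rV[R]_n,
    (forall j, `|g h 0 j - tau x 0 j| < r) ->
    (forall k j, `|xi k 0 j - tau x 0 j| <= `|g h 0 j - tau x 0 j|) /\
    f (g h) - f (tau x) = \sum_k (g h 0 k - tau x 0 k) * partial k f (xi k).
  case: (pselect (forall j, `|g h 0 j - tau x 0 j| < r)) => [gh|]; last by exists (fun=> 0).
  have df (w : 'rV[R]_n) : (forall j, `|w 0 j - tau x 0 j| <= `|g h 0 j - tau x 0 j|) ->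
      forall i, derivable f w (delta_mx 0 i : 'rV[R]_n).
    move=> wz; apply: (cf w _).2; apply: br; split=> // i j.
    by rewrite (ord1 i) -ball_normE /= distrC; exact: le_lt_trans (wz j) (gh j).
  by have [xi b E] := mean_value_path df; exists xi.
have [xi xiP] := choice mean.
have xi_cvg k : (fun h => partial k f (xi h k)) @ 0^' --> partial k f (tau x).
  have w_cvg : xi ^~ k @ 0^' --> tau x.
    apply/cvg_ballP => d d0; near=> h; split=> // i j; rewrite (ord1 i).
    have gr : forall j, `|g h 0 j - tau x 0 j| < r by near: h; exact: g_near.
    have gd : forall j, `|g h 0 j - tau x 0 j| < d by near: h; exact: g_near.
    rewrite -ball_normE /= distrC; exact: le_lt_trans ((xiP h gr).1 k j) (gd j).
  exact: cvg_comp w_cvg (sf [:: k] (tau x) Wx).1.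
have q_cvg : (fun h => \sum_k (h^-1 * (g h 0 k - tau x 0 k)) * partial k f (xi h k))
    @ 0^' --> \sum_k 'D_v (fun y => tau y 0 k) x * partial k f (tau x).
  apply: cvg_big => //; first exact: add_continuous.
  by move=> k _; apply: cvgM => //; exact: dt.
have quot_cvg : (fun h : R => h^-1 *: (((f \o tau) \o shift x) (h *: v) - (f \o tau) x))
    @ 0^' --> \sum_k 'D_v (fun y => tau y 0 k) x * partial k f (tau x).
  apply: cvg_trans q_cvg; apply: near_eq_cvg; near=> h.
  have /xiP[_ E] : forall j, `|g h 0 j - tau x 0 j| < r by near: h; exact: g_near.
  rewrite /= -/(g h) E scaler_sumr; apply: eq_bigr => k _.
  by rewrite [RHS]mulrA.
by apply: DeriveDef; [apply/cvg_ex; eexists; exact: quot_cvg | exact: cvg_lim quot_cvg].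
Unshelve. all: by end_near. Qed.

End ChainRule.

(** * Matrix valued functions *)

(* Locked: otherwise unification of two distinct partial derivatives unfolds
   them down to limits of filters before failing. *)
HB.lock Definition mxpartial (R : realType) (n p q : nat) (i : 'I_n)
    (X : 'rV[R]_n -> 'M[R]_(p, q)) (x : 'rV[R]_n) : 'M[R]_(p, q) :=
  \matrix_(a, b) partial i (fun y => X y a b) x.

Section MatrixCalculus.
Context {R : realType} {n : nat}.
Implicit Types (U : set 'rV[R]_n) (x : 'rV[R]_n).

Lemma mxpartialE {p q} i (X : 'rV[R]_n -> 'M[R]_(p, q)) x a b :
  mxpartial i X x a b = partial i (fun y => X y a b) x.
Proof. by rewrite mxpartial.unlock mxE. Qed.

Record mxsmooth {p q} U (X : 'rV[R]_n -> 'M[R]_(p, q)) : Prop := MxSmooth {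
  mxsmooth_entry : forall a b, smooth_on U (fun x => X x a b) }.

Context {U : set 'rV[R]_n} (oU : open U).

Lemma mxpartial_eq {p q} i (X Y : 'rV[R]_n -> 'M[R]_(p, q)) :
  (forall x, U x -> X x = Y x) ->
  forall x, U x -> mxpartial i X x = mxpartial i Y x.
Proof.
move=> XY x Ux; apply/matrixP => a b; rewrite [LHS]mxpartialE [RHS]mxpartialE.
by apply: partial_eq oU _ x Ux => y /XY ->.
Qed.

Lemma mxsmooth_derivable {p q} (X : 'rV[R]_n -> 'M[R]_(p, q)) a b i x :
  mxsmooth U X -> U x ->
  derivable (fun y => X y a b) x (delta_mx 0 i : 'rV[R]_n).
Proof. by move=> [sX] /(sX a b [::])[_]; exact. Qed.

Lemma mxsmooth_partial {p q} i (X : 'rV[R]_n -> 'M[R]_(p, q)) :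
  mxsmooth U X -> mxsmooth U (mxpartial i X).
Proof.
move=> [sX]; split=> a b.
apply: (smooth_on_eq oU _ (smooth_on_partial i (sX a b))) => x _.
by rewrite mxpartialE.
Qed.

Lemma mxsmoothD {p q} (X Y : 'rV[R]_n -> 'M[R]_(p, q)) :
  mxsmooth U X -> mxsmooth U Y -> mxsmooth U (fun x => X x + Y x).
Proof.
move=> [sX] [sY]; split=> a b.
apply: (smooth_on_eq oU _ (smooth_onD oU (sX a b) (sY a b))).
by move=> x _; rewrite mxE.
Qed.

Lemma mxsmoothN {p q} (X : 'rV[R]_n -> 'M[R]_(p, q)) :
  mxsmooth U X -> mxsmooth U (fun x => - X x).
Proof.
move=> [sX]; split=> a b.
apply: (smooth_on_eq oU _ (smooth_onM oU (@smooth_on_cst _ _ _ (-1)) (sX a b))).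
by move=> x _; rewrite mxE /= mulN1r.
Qed.

Lemma mxsmoothM {p q r} (X : 'rV[R]_n -> 'M[R]_(p, q))
    (Y : 'rV[R]_n -> 'M[R]_(q, r)) :
  mxsmooth U X -> mxsmooth U Y -> mxsmooth U (fun x => X x *m Y x).
Proof.
move=> sX sY; split=> a b.
have sXY k := smooth_onM oU (mxsmooth_entry sX a k) (mxsmooth_entry sY k b).
apply: (smooth_on_eq oU _ (smooth_on_sum (index_enum 'I_q) oU sXY)) => x _.
by rewrite mxE.
Qed.

Lemma mxsmooth_tr {p q} (X : 'rV[R]_n -> 'M[R]_(p, q)) :
  mxsmooth U X -> mxsmooth U (fun x => (X x)^T).
Proof.
move=> [sX]; split=> a b; apply: (smooth_on_eq oU _ (sX b a)) => x _.
by rewrite mxE.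
Qed.

Lemma mxpartialD {p q} i (X Y : 'rV[R]_n -> 'M[R]_(p, q)) x :
  mxsmooth U X -> mxsmooth U Y -> U x ->
  mxpartial i (fun x => X x + Y x) x = mxpartial i X x + mxpartial i Y x.
Proof.
move=> sX sY Ux; apply/matrixP => a b.
rewrite [RHS]mxE !mxpartialE /partial.
rewrite (_ : (fun y => _) = (fun y => X y a b) + (fun y => Y y a b)); last first.
  by apply/funext => y; rewrite mxE.
have dX := mxsmooth_derivable (a := a) (b := b) (i := i) sX Ux.
have dY := mxsmooth_derivable (a := a) (b := b) (i := i) sY Ux.
exact: deriveD dX dY.
Qed.

Lemma mxpartialN {p q} i (X : 'rV[R]_n -> 'M[R]_(p, q)) x :
  mxsmooth U X -> U x -> mxpartial i (fun x => - X x) x = - mxpartial i X x.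
Proof.
move=> sX Ux; apply/matrixP => a b.
rewrite [RHS]mxE !mxpartialE /partial.
rewrite (_ : (fun y => _) = - (fun y => X y a b)); last first.
  by apply/funext => y; rewrite mxE.
exact: deriveN (mxsmooth_derivable (a := a) (b := b) (i := i) sX Ux).
Qed.

(** Derivability at one point is assumed rather than smoothness, because composites with [tau] are
    only shown to be derivable. *)
Lemma mxpartialM_derivable {p q r} i (X : 'rV[R]_n -> 'M[R]_(p, q))
    (Y : 'rV[R]_n -> 'M[R]_(q, r)) x :
  (forall a k, derivable (fun y => X y a k) x (delta_mx 0 i : 'rV[R]_n)) ->
  (forall k b, derivable (fun y => Y y k b) x (delta_mx 0 i : 'rV[R]_n)) ->
  mxpartial i (fun x => X x *m Y x) x
  = mxpartial i X x *m Y x + X x *m mxpartial i Y x.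
Proof.
move=> dX dY; apply/matrixP => a b; rewrite mxpartialE !mxE -big_split /=.
rewrite (_ : (fun y => _) =
  \sum_(k < q) ((fun y => X y a k) * (fun y => Y y k b))); last first.
  by apply/funext => y; rewrite mxE fct_sumE.
rewrite /partial derive_sum; last by move=> k; exact: derivableM (dX a k) (dY k b).
apply: eq_bigr => k _;
  rewrite (deriveM (dX a k) (dY k b)) !mxpartialE addrC /partial.
by congr (_ + _); exact: mulrC.
Qed.

Lemma mxpartialM {p q r} i (X : 'rV[R]_n -> 'M[R]_(p, q))
    (Y : 'rV[R]_n -> 'M[R]_(q, r)) x :
  mxsmooth U X -> mxsmooth U Y -> U x ->
  mxpartial i (fun x => X x *m Y x) x
  = mxpartial i X x *m Y x + X x *m mxpartial i Y x.
Proof.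
move=> sX sY Ux; apply: mxpartialM_derivable => a k; exact: mxsmooth_derivable Ux.
Qed.

Lemma mxpartial_tr {p q} i (X : 'rV[R]_n -> 'M[R]_(p, q)) x :
  mxpartial i (fun x => (X x)^T) x = (mxpartial i X x)^T.
Proof.
apply/matrixP => a b; rewrite [RHS]mxE !mxpartialE (_ : (fun y => _) = (fun y => X y b a)) //.
by apply/funext => y; rewrite mxE.
Qed.

Lemma mxpartialC {p q} i j (X : 'rV[R]_n -> 'M[R]_(p, q)) x :
  mxsmooth U X -> U x ->
  mxpartial j (mxpartial i X) x = mxpartial i (mxpartial j X) x.
Proof.
move=> sX Ux; apply/matrixP => a b; rewrite [LHS]mxpartialE [RHS]mxpartialE.
have E k : (fun y => mxpartial k X y a b) = partial k (fun y => X y a b).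
  by apply/funext => y; rewrite mxpartialE.
by rewrite (E i) (E j); exact: (partialC _ _ oU (mxsmooth_entry sX a b) Ux).
Qed.

(** By Cramer's rule the entries of the inverse are cofactors over the determinant, hence
    polynomials in the entries over a nonvanishing one. *)
Lemma mxsmooth_inv (X : 'rV[R]_n -> 'M[R]_n) :
  (forall x, U x -> X x \in unitmx) -> mxsmooth U X ->
  mxsmooth U (fun x => invmx (X x)).
Proof.
have s_det k (Y : 'rV[R]_n -> 'M[R]_k) :
    mxsmooth U Y -> smooth_on U (fun x => \det (Y x)).
  move=> sY; apply: smooth_on_sum => // s; apply: smooth_onM => //.
    exact: smooth_on_cst.
  by apply: smooth_on_prod => // l; exact: mxsmooth_entry sY _ _.
move=> uX sX; split=> a b.
have s_cof : smooth_on U (fun x => cofactor (X x) b a).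
  apply: smooth_onM => //; first exact: smooth_on_cst.
  apply: s_det; split=> k l.
  by apply: (smooth_on_eq oU _ (mxsmooth_entry sX _ _)) => x _; rewrite !mxE.
have d0 x : U x -> \det (X x) != 0.
  by move=> /uX; rewrite unitmxE unitfE.
have := smooth_onM oU (smooth_onV oU d0 (s_det _ _ sX)) s_cof.
by apply: (smooth_on_eq oU) => x /uX uXx; rewrite /invmx uXx !mxE.
Qed.

End MatrixCalculus.

(** * The local Schur lemma *)

(** For identities in a noncommutative matrix ring: after full expansion every product becomes an
    opaque atom, and the remaining additive identity is checked entrywise. *)
Ltac mx_abel :=
  rewrite ?(mulmxDl, mulmxDr) ?(mulNmx, mulmxN) ?mulmxA;
  repeat match goal with |- context [@mulmx ?S ?p ?q ?r ?X ?Y] =>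
    move: (@mulmx S p q r X Y) => ? end;
  apply/matrixP => ? ?; rewrite !mxE; ring.

(** The letters [m], [i], [j] stand for A_m, A_i, A_j; two letters such as [mi] for d_m A_i; three
    such as [mij] for d_m d_i A_j, with commuting derivatives already identified. *)
Lemma bianchi_algebra (R : comNzRingType) n
    (mij mji ijm mi mj im ij jm ji m i j : 'M[R]_n) :
  (mij - mji + (mi *m j + i *m mj) - (mj *m i + j *m mi)
   + m *m (ij - ji + i *m j - j *m i) - (ij - ji + i *m j - j *m i) *m m) +
  (ijm - mij + (ij *m m + j *m im) - (im *m j + m *m ij)
   + i *m (jm - mj + j *m m - m *m j) - (jm - mj + j *m m - m *m j) *m i) +
  (mji - ijm + (jm *m i + m *m ji) - (ji *m m + i *m jm)
   + j *m (mi - im + m *m i - i *m m) - (mi - im + m *m i - i *m m) *m j)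
  = 0.
Proof. mx_abel. Qed.

(** With [P] the derivative of [F] and g a + a^T g that of [g], the first premise is the derivative
    of the second. Correcting it by multiples of the second gives skewness of the covariant
    derivative of [F]. *)
Lemma skew_algebra (R : comNzRingType) n (g P F a : 'M[R]_n) :
  (g *m a + a^T *m g) *m F + g *m P + (P^T *m g + F^T *m (g *m a + a^T *m g)) = 0 ->
  g *m F + F^T *m g = 0 ->
  g *m (P + a *m F - F *m a) + (P + a *m F - F *m a)^T *m g = 0.
Proof.
move=> E F0.
have tD (X Y : 'M[R]_n) : (X + Y)^T = X^T + Y^T by rewrite linearD.
have tN (X : 'M[R]_n) : (- X)^T = - X^T by rewrite linearN.
transitivity (((g *m a + a^T *m g) *m F + g *m P
    + (P^T *m g + F^T *m (g *m a + a^T *m g)))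
    - (g *m F + F^T *m g) *m a - a^T *m (g *m F + F^T *m g)).
  by rewrite !(tD, tN, trmx_mul); mx_abel.
by rewrite E F0 mul0mx mulmx0 !subr0.
Qed.

(* With A i the matrix of Christoffel symbols (l, k) |-> Gamma^l_ik, the (l, k)
   entry of curv A i j is the component of the l-th coordinate vector field in
   R(d_i, d_j) d_k. *)
Definition curv {R : realType} {n : nat} (A : 'I_n -> 'rV[R]_n -> 'M[R]_n)
    (i j : 'I_n) (x : 'rV[R]_n) : 'M[R]_n :=
  mxpartial i (A j) x - mxpartial j (A i) x + A i x *m A j x - A j x *m A i x.

Section LocalSchur.
Context {R : realType} {n : nat} {U : set 'rV[R]_n} (oU : open U).
Context {G : 'rV[R]_n -> 'M[R]_n} {A : 'I_n -> 'rV[R]_n -> 'M[R]_n}.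
Hypothesis G_smooth : mxsmooth U G.
Hypothesis A_smooth : forall i, mxsmooth U (A i).
Hypothesis G_sym : forall x, U x -> (G x)^T = G x.
Hypothesis G_unit : forall x, U x -> G x \in unitmx.
Hypothesis A_metric : forall i x, U x ->
  mxpartial i G x = G x *m A i x + (A i x)^T *m G x.
Hypothesis A_torsion_free : forall i j l x, U x -> A i x l j = A j x l i.

Let dA_smooth i j : mxsmooth U (mxpartial i (A j)).
Proof. exact: mxsmooth_partial. Qed.

Let AA_smooth i j : mxsmooth U (fun x => A i x *m A j x).
Proof. exact: mxsmoothM. Qed.

Lemma curv_smooth i j : mxsmooth U (curv A i j).
Proof.
apply: mxsmoothD => //; last exact: mxsmoothN.
by apply: mxsmoothD => //; apply: mxsmoothD => //; exact: mxsmoothN.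
Qed.

Lemma curvC i j x : curv A j i x = - curv A i j x.
Proof.
by rewrite /curv !opprD !opprK addrAC [- _ + mxpartial _ _ _]addrC.
Qed.

(** Second partials of [G] commute; expanding both orders by [A_metric], their difference is, up to
    sign, the left-hand side. *)
Lemma curv_skew i j x : U x -> G x *m curv A i j x + (curv A i j x)^T *m G x = 0.
Proof.
move=> Ux; have := mxpartialC oU i j G_smooth Ux.
have dd k l : mxpartial k (mxpartial l G) x =
    (G x *m A k x + (A k x)^T *m G x) *m A l x + G x *m mxpartial k (A l) x
    + ((mxpartial k (A l) x)^T *m G x
       + (A l x)^T *m (G x *m A k x + (A k x)^T *m G x)).
  have sT m : mxsmooth U (fun x => (A m x)^T) by exact: mxsmooth_tr.
  rewrite (mxpartial_eq oU k (A_metric l) Ux).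
  rewrite (mxpartialD k (mxsmoothM oU _ _) (mxsmoothM oU _ _)) //.
  by rewrite !(mxpartialM (U := U)) // mxpartial_tr A_metric.
rewrite !dd /curv => /eqP; rewrite -subr_eq0 => /eqP E.
rewrite -[RHS]oppr0 -E; move: (mxpartial i (A j) x) (mxpartial j (A i) x) => P Q.
move: (A i x) (A j x) (G x) => a b g.
have tD (X Y : 'M[R]_n) : (X + Y)^T = X^T + Y^T by rewrite linearD.
have tN (X : 'M[R]_n) : (- X)^T = - X^T by rewrite linearN.
by rewrite !(tD, tN, trmx_mul); mx_abel.
Qed.

(* dcurv is the covariant derivative of the endomorphisms curv A i j; ncurv also
   differentiates the two form slots i, j. *)
Definition dcurv (m i j : 'I_n) (x : 'rV[R]_n) : 'M[R]_n :=
  mxpartial m (curv A i j) x + A m x *m curv A i j x - curv A i j x *m A m x.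

Lemma dcurvE m i j x : U x -> dcurv m i j x =
  mxpartial m (mxpartial i (A j)) x - mxpartial m (mxpartial j (A i)) x
  + (mxpartial m (A i) x *m A j x + A i x *m mxpartial m (A j) x)
  - (mxpartial m (A j) x *m A i x + A j x *m mxpartial m (A i) x)
  + A m x *m curv A i j x - curv A i j x *m A m x.
Proof.
move=> Ux; rewrite /dcurv {1}/curv; congr (_ + _ - _).
have sB : mxsmooth U (fun x => mxpartial i (A j) x - mxpartial j (A i) x).
  by apply: mxsmoothD => //; exact: mxsmoothN.
rewrite (mxpartialD m (mxsmoothD oU sB _) (mxsmoothN oU _)) //.
rewrite (mxpartialD m sB) // (mxpartialD m _ (mxsmoothN oU _)) //.
by rewrite !(mxpartialN (U := U)) // !(mxpartialM (U := U)).
Qed.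

(** The second Bianchi identity: second derivatives of the A_i cancel in pairs since partials
    commute, and the cubic terms by the Jacobi identity. *)
Lemma dcurv_cyclic m i j x : U x ->
  dcurv m i j x + dcurv i j m x + dcurv j m i x = 0.
Proof.
move=> Ux; rewrite !dcurvE // (mxpartialC oU m i (A_smooth j)) //.
rewrite (mxpartialC oU j m (A_smooth i)) // (mxpartialC oU j i (A_smooth m)) // /curv.
exact: bianchi_algebra.
Qed.

Definition ncurv (m i j : 'I_n) (x : 'rV[R]_n) : 'M[R]_n :=
  dcurv m i j x - \sum_p A m x p i *: curv A p j x - \sum_p A m x p j *: curv A i p x.

Lemma ncurv_cyclic m i j x : U x ->
  ncurv m i j x + ncurv i j m x + ncurv j m i x = 0.
Proof.
move=> Ux; have D0 := dcurv_cyclic m i j Ux.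
(* Torsion freeness exchanges the lower indices while the curvature changes sign, so the six
   correction sums of the cyclic sum cancel in pairs. *)
have sA k l a : \sum_p A k x p l *: curv A a p x = - \sum_p A l x p k *: curv A p a x.
  by rewrite -sumrN; apply: eq_bigr => p _; rewrite (A_torsion_free k l) // curvC scalerN.
rewrite /ncurv (sA m j i) // (sA i m j) // (sA j i m) // !opprK.
rewrite -[RHS]D0.
move: (\sum_p _) (\sum_p _) (\sum_p _) (dcurv _ _ _ _) (dcurv _ _ _ _) (dcurv _ _ _ _).
by move=> *; mx_abel.
Qed.

Lemma ncurvC m i j x : U x -> ncurv m j i x = - ncurv m i j x.
Proof.
move=> Ux; have dC : dcurv m j i x = - dcurv m i j x.
  have pC : mxpartial m (curv A j i) x = - mxpartial m (curv A i j) x.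
    have -> : curv A j i = (fun y => - curv A i j y) by apply/funext => y; exact: curvC.
    exact: mxpartialN (curv_smooth i j) Ux.
  rewrite /dcurv pC (curvC i j).
  move: (mxpartial _ _ _) (curv A _ _ _) (A _ _) => *.
  by mx_abel.
have sC k l : \sum_p A m x p k *: curv A p l x = - \sum_p A m x p k *: curv A l p x.
  by rewrite -sumrN; apply: eq_bigr => p _; rewrite curvC scalerN.
by rewrite /ncurv dC (sC j i) (sC i j) !opprD !opprK addrAC.
Qed.

(** Skew endomorphisms form a linear space that contains all [curv A i j x] and, by differentiating
    [curv_skew], also [dcurv m i j x]. *)
Lemma ncurv_skew m i j x : U x ->
  G x *m ncurv m i j x + (ncurv m i j x)^T *m G x = 0.
Proof.
move=> Ux.
have skewB (X Y : 'M[R]_n) : G x *m X + X^T *m G x = 0 ->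
    G x *m Y + Y^T *m G x = 0 -> G x *m (X - Y) + (X - Y)^T *m G x = 0.
  have -> : (X - Y)^T = X^T - Y^T by rewrite linearB.
  by move=> X0 Y0; rewrite mulmxBr mulmxBl addrACA X0 -opprD Y0 subr0.
have sum_skew (I : finType) (c : I -> R) (F : I -> 'M[R]_n) :
    (forall p, G x *m F p + (F p)^T *m G x = 0) ->
    G x *m (\sum_p c p *: F p) + (\sum_p c p *: F p)^T *m G x = 0.
  move=> F0; have -> : (\sum_p c p *: F p)^T = \sum_p (c p *: F p)^T.
    by rewrite linear_sum.
  rewrite mulmx_sumr mulmx_suml -big_split big1 //= => p _.
  by rewrite trmxZ -scalemxAr -scalemxAl -scalerDr F0 scaler0.
have d_skew : G x *m dcurv m i j x + (dcurv m i j x)^T *m G x = 0.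
  have cT : mxsmooth U (fun y => (curv A i j y)^T) by apply/mxsmooth_tr/curv_smooth.
  have cs := curv_smooth i j.
  have := mxpartial_eq oU m (Y := fun=> 0) (fun y => @curv_skew i j y) Ux.
  have -> : mxpartial m (fun=> 0) x = 0 :> 'M[R]_n.
    by apply/matrixP => a b; rewrite mxpartialE [RHS]mxE; exact: derive_cst.
  rewrite (mxpartialD m (mxsmoothM oU _ _) (mxsmoothM oU _ _)) //.
  rewrite !(mxpartialM (U := U)) // mxpartial_tr A_metric // => E.
  exact: skew_algebra E (curv_skew i j Ux).
have s1 := @sum_skew 'I_n (fun p => A m x p i) (fun p => curv A p j x)
  (fun p => curv_skew p j Ux).
have s2 := @sum_skew 'I_n (fun p => A m x p j) (fun p => curv A i p x)
  (fun p => curv_skew i p Ux).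
exact: skewB (skewB _ _ d_skew s1) s2.
Qed.

Context {h : 'rV[R]_n -> R}.
Hypothesis h_smooth : smooth_on U h.
Hypothesis Ric_h : forall j k x, U x -> \sum_i curv A i j x i k = h x * G x j k.

(** Covariant differentiation commutes with the trace that defines Ric and annihilates the metric,
    so only the derivative of [h] survives. *)
Lemma ncurv_contract m j k x : U x ->
  \sum_i ncurv m i j x i k = partial m h x * G x j k.
Proof.
move=> Ux.
have d_trace : \sum_i mxpartial m (curv A i j) x i k
    = partial m h x * G x j k + h x * mxpartial m G x j k.
  transitivity (partial m (fun y => \sum_i curv A i j y i k) x).
    rewrite /partial -fct_sumE derive_sum.
      by apply: eq_bigr => i _; rewrite mxpartialE.
    by move=> i; exact: mxsmooth_derivable (curv_smooth i j) Ux.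
  rewrite (partial_eq m oU (g := h * (fun y => G y j k))); first last.
  - exact: Ux.
  - by move=> y Uy; rewrite Ric_h.
  rewrite mxpartialE /partial deriveM; first by rewrite addrC mulrC; congr (_ + _).
    by have [_] := h_smooth [::] Ux.
  exact: mxsmooth_derivable G_smooth Ux.
rewrite A_metric // in d_trace.
have -> : \sum_i ncurv m i j x i k = \sum_i mxpartial m (curv A i j) x i k
    + \sum_i \sum_p A m x i p * curv A i j x p k
    - \sum_i \sum_p curv A i j x i p * A m x p k
    - \sum_i \sum_p A m x p i * curv A p j x i k
    - \sum_i \sum_p A m x p j * curv A i p x i k.
  rewrite -big_split -!sumrB; apply: eq_bigr => i _ /=.
  rewrite /ncurv /dcurv !mxE !summxE.
  by congr (_ + _ - _ - _ - _); apply: eq_bigr => p _; rewrite mxE.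
(* After this exchange the correction for the traced upper index equals the one for the slot [i],
   and they cancel. The two remaining sums are [h] times the connection terms of [mxpartial m G]. *)
rewrite d_trace [X in _ + X - _ - _ - _]exchange_big /= addrAC.
have -> : \sum_i \sum_p curv A i j x i p * A m x p k = h x * (G x *m A m x) j k.
  rewrite exchange_big mxE mulr_sumr; apply: eq_bigr => p _.
  by rewrite -mulr_suml Ric_h // mulrA.
have -> : \sum_i \sum_p A m x p j * curv A i p x i k = h x * ((A m x)^T *m G x) j k.
  rewrite exchange_big mxE mulr_sumr; apply: eq_bigr => p _.
  by rewrite -mulr_sumr Ric_h // mxE mulrCA.
rewrite [in LHS]mxE; ring.
Qed.

Lemma schur_partial m x : (2 < n)%N -> U x -> partial m h x = 0.
Proof.
move=> n2 Ux; set H := invmx (G x); have uG := G_unit Ux.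
have HG : H *m G x = 1%:M by exact: mulVmx.
have GH : G x *m H = 1%:M by exact: mulmxV.
have H_sym : H^T = H by rewrite trmx_inv G_sym.
pose d i := partial i h x.
(* Contracting [G] with its inverse relabels the index of a covector. *)
have GH_sum i (c : 'I_n -> R) : \sum_j \sum_k H k j * (c j * G x i k) = c i.
  under eq_bigr => j _ do under eq_bigr => k _ do rewrite mulrCA [H _ _ * _]mulrC.
  under eq_bigr => j _ do rewrite -mulr_sumr.
  have GHij j : \sum_k G x i k * H k j = (i == j)%:R.
    by have := congr1 (fun X : 'M[R]_n => X i j) GH; rewrite !mxE.
  under eq_bigr => j _ do rewrite GHij.
  rewrite (bigD1 i) //= eqxx mulr1 big1 ?addr0 // => j ji.
  by rewrite eq_sym (negbTE ji) mulr0.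
have first_term : \sum_j \sum_k H k j * \sum_i ncurv m i j x i k = n%:R * d m.
  under eq_bigr => j _ do under eq_bigr => k _ do rewrite ncurv_contract // mulrCA.
  under eq_bigr => j _ do rewrite -mulr_sumr.
  have HGjj j : \sum_k H k j * G x j k = 1.
    transitivity ((G x *m H) j j); last by rewrite GH mxE eqxx.
    by rewrite mxE; apply: eq_bigr => k _; rewrite mulrC.
  under eq_bigr => j _ do rewrite HGjj mulr1.
  by rewrite sumr_const card_ord mulr_natl.
(* Exchanging the two form slots brings the traced one into the first place, as [ncurv_contract]
   requires, at the cost of a sign. *)
have third_term : \sum_j \sum_k H k j * \sum_i ncurv j m i x i k = - d m.
  rewrite -[in RHS](GH_sum m d) -sumrN; apply: eq_bigr => j _.
  rewrite -sumrN; apply: eq_bigr => k _; rewrite -mulrN -ncurv_contract //.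
  by rewrite -sumrN; congr (_ * _); apply: eq_bigr => i _; rewrite ncurvC // mxE.
(* Here the upper index is traced against the direction of differentiation. With the lower index
   raised by [H] the matrix is skew; transposing it traces the upper index against the form slot [j]
   instead. *)
have middle_term : \sum_j \sum_k H k j * \sum_i ncurv i j m x i k = - d m.
  have NH_skew i j : (ncurv i j m x *m H)^T = - (ncurv i j m x *m H).
    have := congr1 (fun X => H *m X *m H) (ncurv_skew i j m Ux).
    rewrite mulmxDr mulmxDl mulmx0 mul0mx !mulmxA HG mul1mx -!mulmxA GH mulmx1.
    by rewrite trmx_mul H_sym => /eqP; rewrite addr_eq0 => /eqP ->; rewrite opprK.
  transitivity (\sum_i \sum_j (ncurv i j m x *m H) i j).
    rewrite [RHS]exchange_big /=; apply: eq_bigr => j _.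
    under eq_bigr => k _ do rewrite mulr_sumr.
    rewrite exchange_big /=; apply: eq_bigr => i _; rewrite mxE.
    by apply: eq_bigr => k _; rewrite mulrC.
  transitivity (- \sum_i \sum_k H k i * \sum_j ncurv i j m x j k).
    rewrite -sumrN; apply: eq_bigr => i _.
    transitivity (- \sum_j (ncurv i j m x *m H) j i).
      rewrite -sumrN; apply: eq_bigr => j _.
      have := congr1 (fun X : 'M[R]_n => X j i) (NH_skew i j).
      by rewrite [in LHS]mxE => ->; rewrite mxE.
    congr (- _); under [RHS]eq_bigr => k _ do rewrite mulr_sumr.
    rewrite [RHS]exchange_big; apply: eq_bigr => j _; rewrite mxE.
    by apply: eq_bigr => k _; rewrite mulrC.
  congr (- _); rewrite -[RHS](GH_sum m d); apply: eq_bigr => i _.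
  by apply: eq_bigr => k _; rewrite ncurv_contract.
have : n%:R * d m - d m - d m = 0.
  rewrite -[in X in X - _ - _]first_term -[X in _ + X - _]middle_term -third_term.
  rewrite -!big_split big1 //= => j _; rewrite -!big_split big1 //= => k _.
  rewrite -!mulrDr -!big_split big1 ?mulr0 //= => i _.
  have := congr1 (fun X : 'M[R]_n => X i k) (ncurv_cyclic m i j Ux).
  by rewrite mxE [X in X + _]mxE [RHS]mxE.
move=> /eqP; rewrite -addrA -opprD -mulr2n -(mulr_natl (d m) 2) -mulrBl mulf_eq0.
case/orP => [|/eqP //]; rewrite subr_eq0 eqr_nat => /eqP n_eq.
by rewrite n_eq in n2.
Qed.

End LocalSchur.

(** * Ricci curvature under a change of coordinates *)

(** Here [q] is P, [d] its derivative, [b] the pulled back connection and [a] the one upstairs. The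
    premise equates two expressions for the derivative of q^T g q. *)
Lemma connection_algebra (R : comNzRingType) n (g q d b a : 'M[R]_n) :
  g^T = g ->
  (d^T *m g + q^T *m (g *m b + b^T *m g)) *m q + q^T *m g *m d
    = q^T *m g *m q *m a + a^T *m (q^T *m g *m q) ->
  q^T *m g *m (q *m a - b *m q - d) + (q^T *m g *m (q *m a - b *m q - d))^T = 0.
Proof.
move=> gT E.
have tD (X Y : 'M[R]_n) : (X + Y)^T = X^T + Y^T by rewrite linearD.
have tN (X : 'M[R]_n) : (- X)^T = - X^T by rewrite linearN.
transitivity (q^T *m g *m q *m a + a^T *m (q^T *m g *m q)
  - ((d^T *m g + q^T *m (g *m b + b^T *m g)) *m q + q^T *m g *m d)); last first.
  by rewrite E subrr.
by rewrite !(tD, tN, trmx_mul, trmxK) gT; mx_abel.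
Qed.

(** Applying the two transpositions alternately, three times each, returns every index to its place
    with sign (-1)^3, so K = -K. *)
Lemma sym_skew_eq0 (R : numDomainType) (I : Type) (K : I -> I -> I -> R) :
  (forall i j l, K i l j = - K i j l) -> (forall i j l, K i l j = K j l i) ->
  forall i j l, K i l j = 0.
Proof.
move=> skew sym i j l; apply/eqP; rewrite -eqNr; apply/eqP/esym.
rewrite [LHS]skew [K i j l]sym [K l j i]skew opprK.
by rewrite [K l i j]sym [K j i l]skew [K j l i]sym.
Qed.

(** The first two premises are derivatives of the last two, with [dd] the mixed second derivative of
    [q]. Antisymmetrising in [i], [j] removes [dd], and the last two premises handle the quadratic
    terms. *)
Lemma gauge_algebra (R : comNzRingType) n
    (q ai aj bi bj di dj dd iaj jai ibj jbi : 'M[R]_n) :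
  ibj *m q + bj *m di = di *m aj + q *m iaj - dd ->
  jbi *m q + bi *m dj = dj *m ai + q *m jai - dd ->
  q *m ai = bi *m q + di -> q *m aj = bj *m q + dj ->
  q *m (iaj - jai + ai *m aj - aj *m ai)
  = (ibj - jbi + bi *m bj - bj *m bi) *m q.
Proof.
move=> Ei Ej Qi Qj.
have Qij : q *m ai *m aj = bi *m bj *m q + bi *m dj + di *m aj.
  by rewrite Qi mulmxDl -mulmxA Qj mulmxDr mulmxA.
have Qji : q *m aj *m ai = bj *m bi *m q + bj *m di + dj *m ai.
  by rewrite Qj mulmxDl -mulmxA Qi mulmxDr mulmxA.
transitivity ((di *m aj + q *m iaj - dd) - (dj *m ai + q *m jai - dd)
    + q *m ai *m aj - q *m aj *m ai - di *m aj + dj *m ai).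
  by mx_abel.
by rewrite -Ei -Ej Qij Qji; mx_abel.
Qed.

Definition Jac {R : realType} {n : nat} (tau : 'rV[R]_n -> 'rV[R]_n)
    (x : 'rV[R]_n) : 'M[R]_n :=
  \matrix_(i, j) partial i (fun y => tau y 0 j) x.

Section ChangeOfCoordinates.
Context {R : realType} {n : nat} {V W : set 'rV[R]_n}.
Context (oV : open V) (oW : open W) {tau : 'rV[R]_n -> 'rV[R]_n}.
Hypothesis tau_smooth : forall j, smooth_on V (fun x => tau x 0 j).
Hypothesis tau_W : forall x, V x -> W (tau x).

(** The differential of [tau] on column vectors; [Jac], like [jac], has the source coordinate as row
    index. *)
Let P (x : 'rV[R]_n) : 'M[R]_n := (Jac tau x)^T.

Lemma Jac_smooth : mxsmooth V (Jac tau).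
Proof.
split=> i j.
apply: (smooth_on_eq oV _ (smooth_on_partial i (tau_smooth j))) => x _.
by rewrite mxE.
Qed.

Let P_smooth : mxsmooth V P.
Proof. by have := mxsmooth_tr oV Jac_smooth. Qed.

Lemma partial_Jac i j k x : V x ->
  partial i (fun y => Jac tau y j k) x = partial j (fun y => Jac tau y i k) x.
Proof.
move=> Vx.
have E l : (fun y => Jac tau y l k) = partial l (fun y => tau y 0 k).
  by apply/funext => y; rewrite mxE.
rewrite (E i) (E j); exact: (partialC _ _ oV (tau_smooth k) Vx).
Qed.

Lemma is_derive_pullback (f : 'rV[R]_n -> R) i x : smooth_on W f -> V x ->
  is_derive x (delta_mx 0 i : 'rV[R]_n) (fun y => f (tau y))
    (\sum_k Jac tau x i k * partial k f (tau x)).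
Proof.
move=> sf Vx.
have E : \sum_k Jac tau x i k * partial k f (tau x)
    = \sum_k 'D_(delta_mx 0 i : 'rV[R]_n) (fun y => tau y 0 k) x * partial k f (tau x).
  by apply: eq_bigr => k _; rewrite mxE.
rewrite E; apply: (is_derive_comp_coords oW sf (tau_W Vx)) => j.
  exact: (tau_smooth j [::] Vx).1.
exact: (tau_smooth j [::] Vx).2.
Qed.

Lemma mxpartial_pullback (X : 'rV[R]_n -> 'M[R]_n) i x : mxsmooth W X -> V x ->
  mxpartial i (fun y => X (tau y)) x
  = \sum_k Jac tau x i k *: mxpartial k X (tau x).
Proof.
move=> [sX] Vx; apply/matrixP => a b; rewrite mxpartialE summxE.
transitivity (\sum_k Jac tau x i k * partial k (fun y => X y a b) (tau x)).
  by have [_] := is_derive_pullback i (sX a b) Vx.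
by apply: eq_bigr => k _; rewrite [RHS]mxE; congr (_ * _); rewrite [RHS]mxpartialE.
Qed.

Lemma derivable_pullback (X : 'rV[R]_n -> 'M[R]_n) i x a b : mxsmooth W X -> V x ->
  derivable (fun y => X (tau y) a b) x (delta_mx 0 i : 'rV[R]_n).
Proof. by move=> [sX] Vx; have [] := is_derive_pullback i (sX a b) Vx. Qed.

Context {Ga Gb : 'rV[R]_n -> 'M[R]_n} {A B : 'I_n -> 'rV[R]_n -> 'M[R]_n}.
Hypothesis A_smooth : forall i, mxsmooth V (A i).
Hypothesis Ga_unit : forall x, V x -> Ga x \in unitmx.
Hypothesis A_metric : forall i x, V x ->
  mxpartial i Ga x = Ga x *m A i x + (A i x)^T *m Ga x.
Hypothesis A_torsion_free : forall i j l x, V x -> A i x l j = A j x l i.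
Hypothesis Gb_smooth : mxsmooth W Gb.
Hypothesis B_smooth : forall i, mxsmooth W (B i).
Hypothesis Gb_sym : forall x, W x -> (Gb x)^T = Gb x.
Hypothesis B_metric : forall i x, W x ->
  mxpartial i Gb x = Gb x *m B i x + (B i x)^T *m Gb x.
Hypothesis B_torsion_free : forall i j l x, W x -> B i x l j = B j x l i.
Hypothesis G_change : forall x, V x ->
  Ga x = Jac tau x *m Gb (tau x) *m (Jac tau x)^T.

(** Only the form index is pulled back; the matrix indices still refer to the frame of the target
    chart, and [P] mediates between the frames. *)
Definition pullback_conn (i : 'I_n) (x : 'rV[R]_n) : 'M[R]_n :=
  \sum_k Jac tau x i k *: B k (tau x).

(* Uniqueness of the metric torsion free connection: the difference E of the two
   sides, with an index lowered by Ga, is skew in two slots and symmetric in two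
   others. *)
Lemma connection_change i x : V x ->
  P x *m A i x = pullback_conn i x *m P x + mxpartial i P x.
Proof.
move=> Vx; have Wx := tau_W Vx.
pose E k := P x *m A k x - pullback_conn k x *m P x - mxpartial k P x.
suff E0 : E i = 0.
  by apply/eqP; rewrite -subr_eq0 opprD addrA -/(E i) E0.
pose Q := (P x)^T *m Gb (tau x).
(* Invertibility is read off [G_change], since a square factor of the invertible [Ga x] is
   invertible. *)
have Q_unit : Q \in unitmx.
  have := Ga_unit Vx; rewrite G_change // unitmx_mul => /andP[+ _].
  by rewrite /Q /P trmxK.
suff K0 : Q *m E i = 0 by rewrite -[E i](mulKmx Q_unit) K0 mulmx0.
have P_tr : (P x)^T = Jac tau x by rewrite trmxK.
have dGb k : mxpartial k (fun y => Gb (tau y)) x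
    = Gb (tau x) *m pullback_conn k x + (pullback_conn k x)^T *m Gb (tau x).
  rewrite mxpartial_pullback //.
  have -> : (pullback_conn k x)^T = \sum_l Jac tau x k l *: (B l (tau x))^T.
    by rewrite linear_sum; apply: eq_bigr => l _; exact: trmxZ.
  rewrite mulmx_sumr mulmx_suml -big_split; apply: eq_bigr => l _ /=.
  by rewrite B_metric // scalerDr scalemxAr scalemxAl.
have dGa k : mxpartial k Ga x =
    ((mxpartial k P x)^T *m Gb (tau x) + (P x)^T *m mxpartial k (fun y => Gb (tau y)) x)
      *m P x + (P x)^T *m Gb (tau x) *m mxpartial k P x.
  have dJ a b : derivable (fun y => (P y)^T a b) x (delta_mx 0 k : 'rV[R]_n).
    exact: mxsmooth_derivable (mxsmooth_tr oV P_smooth) Vx.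
  have dG a b := derivable_pullback (i := k) (a := a) (b := b) Gb_smooth Vx.
  have dP a b : derivable (fun y => P y a b) x (delta_mx 0 k : 'rV[R]_n).
    exact: mxsmooth_derivable P_smooth Vx.
  have GE y : V y -> Ga y = (P y)^T *m Gb (tau y) *m P y.
    by move=> Vy; rewrite G_change // /P trmxK.
  have dJG a b : derivable (fun y => ((P y)^T *m Gb (tau y)) a b) x
      (delta_mx 0 k : 'rV[R]_n).
    rewrite (_ : (fun y => _) =
      \sum_(c < n) ((fun y => (P y)^T a c) * (fun y => Gb (tau y) c b))).
      by apply: derivable_sum => c; exact: derivableM (dJ a c) (dG c b).
    by apply/funext => y; rewrite mxE fct_sumE.
  rewrite (mxpartial_eq oV k GE Vx) (mxpartialM_derivable dJG dP).
  by rewrite (mxpartialM_derivable dJ dG) mxpartial_tr.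
have skew k : Q *m E k + (Q *m E k)^T = 0.
  have := A_metric k Vx; rewrite dGa dGb G_change // -P_tr trmxK.
  exact: connection_algebra (Gb_sym Wx).
have sym k j l : E k l j = E j l k.
  have sym1 : (P x *m A k x) l j = (P x *m A j x) l k.
    by rewrite !mxE; apply: eq_bigr => p _; rewrite A_torsion_free.
  have sym2 : (pullback_conn k x *m P x) l j = (pullback_conn j x *m P x) l k.
    have pE a b : (pullback_conn a x *m P x) l b =
        \sum_p \sum_q Jac tau x a q * B q (tau x) l p * Jac tau x b p.
      rewrite mxE; apply: eq_bigr => p _; rewrite summxE mulr_suml.
      by apply: eq_bigr => q _; rewrite mxE [P x _ _]mxE.
    rewrite !pE exchange_big; apply: eq_bigr => q _; apply: eq_bigr => p _.
    by rewrite (B_torsion_free q p l Wx); ring.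
  have sym3 : mxpartial k P x l j = mxpartial j P x l k.
    have PE a : (fun y => P y l a) = (fun y => Jac tau y a l) by apply/funext => y; rewrite mxE.
    by rewrite [LHS]mxpartialE [RHS]mxpartialE (PE j) (PE k); exact: (partial_Jac k j l Vx).
  have EE a b : E a l b = (P x *m A a x) l b - (pullback_conn a x *m P x) l b
      - mxpartial a P x l b.
    have mxB (X Y : 'M[R]_n) : (X - Y) l b = X l b - Y l b by rewrite !mxE.
    by rewrite /E !mxB.
  by apply: (etrans (EE k j)); rewrite sym1 sym2 sym3; exact: esym (EE j k).
apply/matrixP => a b; rewrite [RHS]mxE.
apply: (sym_skew_eq0 (K := fun i l j => (Q *m E i) l j)) => [k j l|k j l].
  have := congr1 (fun X : 'M[R]_n => X l j) (skew k).
  by rewrite mxE [_^T _ _]mxE [RHS]mxE => /eqP; rewrite addr_eq0 => /eqP.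
by rewrite /= [LHS]mxE [RHS]mxE; apply: eq_bigr => p _; congr (_ * _); exact: sym.
Qed.

Let dJac i j k x : V x ->
  derivable (fun y => Jac tau y j k) x (delta_mx 0 i : 'rV[R]_n).
Proof. by move=> Vx; exact: mxsmooth_derivable Jac_smooth Vx. Qed.

Let pullback_entry j a b : (fun y => pullback_conn j y a b)
  = \sum_l ((fun y => Jac tau y j l) * (fun y => B l (tau y) a b)).
Proof.
apply/funext => y; rewrite fct_sumE summxE.
by apply: eq_bigr => l _; rewrite mxE.
Qed.

Lemma derivable_pullback_conn i j a b x : V x ->
  derivable (fun y => pullback_conn j y a b) x (delta_mx 0 i : 'rV[R]_n).
Proof.
move=> Vx; rewrite pullback_entry; apply: derivable_sum => l.
by apply: derivableM; [exact: dJac | exact: derivable_pullback].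
Qed.

Lemma mxpartial_pullback_conn i j x : V x ->
  mxpartial i (pullback_conn j) x =
  \sum_l partial i (fun y => Jac tau y j l) x *: B l (tau x)
  + \sum_k \sum_l (Jac tau x i k * Jac tau x j l) *: mxpartial k (B l) (tau x).
Proof.
move=> Vx; apply/matrixP => a b; rewrite mxpartialE pullback_entry /partial.
have dJ l : derivable (fun y => Jac tau y j l) x (delta_mx 0 i : 'rV[R]_n) := dJac Vx.
have dB l : derivable (fun y => B l (tau y) a b) x (delta_mx 0 i : 'rV[R]_n) :=
  derivable_pullback (B_smooth l) Vx.
rewrite derive_sum; last by move=> l; exact: derivableM (dJ l) (dB l).
rewrite exchange_big -big_split summxE; apply: eq_bigr => l _ /=.
rewrite (deriveM (dJ l) (dB l)).
rewrite [LHS]addrC [RHS]mxE [X in _ = X + _]mxE; congr (_ + _); first exact: mulrC.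
have := congr1 (fun X : 'M[R]_n => X a b) (mxpartial_pullback i (B_smooth l) Vx).
rewrite mxpartialE /partial => ->; rewrite !summxE.
rewrite [LHS]mulr_sumr; apply: eq_bigr => k _.
have ZE (c : R) (X : 'M[R]_n) : (c *: X) a b = c * X a b by rewrite mxE.
by rewrite !ZE mulrCA mulrA.
Qed.

(** The relation of [connection_change] holds on all of the open set [V], so it may be
    differentiated; [gauge_algebra] then eliminates the derivatives of [P]. *)
Lemma curv_connection_change i j x : V x ->
  P x *m curv A i j x = curv pullback_conn i j x *m P x.
Proof.
move=> Vx.
have dP k a b : derivable (fun y => P y a b) x (delta_mx 0 k : 'rV[R]_n).
  exact: mxsmooth_derivable P_smooth Vx.
have E k l : mxpartial k (pullback_conn l) x *m P x
    + pullback_conn l x *m mxpartial k P x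
    = mxpartial k P x *m A l x + P x *m mxpartial k (A l) x
      - mxpartial k (mxpartial l P) x.
  have dB a b : derivable (fun y => pullback_conn l y a b) x
      (delta_mx 0 k : 'rV[R]_n) := derivable_pullback_conn Vx.
  rewrite -(mxpartialM_derivable dB (dP k)) -(mxpartialM k P_smooth (A_smooth l) Vx).
  have sPA : mxsmooth V (fun y => P y *m A l y) by exact: mxsmoothM.
  have sdP : mxsmooth V (mxpartial l P) by exact: mxsmooth_partial.
  rewrite -(mxpartialN k sdP Vx) -(mxpartialD k sPA (mxsmoothN oV sdP) Vx).
  by apply: (mxpartial_eq oV _ _ Vx) => y Vy; rewrite connection_change // addrK.
apply: gauge_algebra (E i j) _ (connection_change i Vx) (connection_change j Vx).
rewrite (mxpartialC oV j i P_smooth Vx); exact: E.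
Qed.

(** The second derivatives of [tau] are symmetric in [i], [j] and drop out of the antisymmetrised
    expression. *)
Lemma curv_pullback i j x : V x ->
  curv pullback_conn i j x =
  \sum_k \sum_l (Jac tau x i k * Jac tau x j l) *: curv B k l (tau x).
Proof.
move=> Vx; rewrite /curv !mxpartial_pullback_conn //.
have prod a b : pullback_conn a x *m pullback_conn b x
    = \sum_k \sum_l (Jac tau x a k * Jac tau x b l) *: (B k (tau x) *m B l (tau x)).
  rewrite mulmx_suml; apply: eq_bigr => k _; rewrite mulmx_sumr.
  by apply: eq_bigr => l _; rewrite -scalemxAl -scalemxAr scalerA.
rewrite (prod i j) (prod j i).
have -> : \sum_l partial i (fun y => Jac tau y j l) x *: B l (tau x)
    = \sum_l partial j (fun y => Jac tau y i l) x *: B l (tau x).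
  by apply: eq_bigr => l _; rewrite (partial_Jac i j l Vx).
rewrite opprD addrACA subrr add0r.
rewrite [X in _ - X + _ - _]exchange_big [X in _ - X]exchange_big /=.
rewrite -sumrB -big_split -sumrB; apply: eq_bigr => k _ /=.
rewrite -sumrB -big_split -sumrB; apply: eq_bigr => l _ /=.
by rewrite [Jac tau x j l * _]mulrC -scalerBr -scalerDr -scalerBr.
Qed.

Lemma ricci_change j k x : V x ->
  \sum_i curv A i j x i k =
  \sum_l \sum_t Jac tau x j l * Jac tau x k t * \sum_s curv B s l (tau x) s t.
Proof.
move=> Vx.
have P_unit : P x \in unitmx.
  have := Ga_unit Vx; rewrite G_change // unitmx_mul => /andP[_ +].
  by [].
have cE i : curv A i j x = \sum_p \sum_l (Jac tau x i p * Jac tau x j l) *: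
    (invmx (P x) *m curv B p l (tau x) *m P x).
  rewrite -[LHS](mulKmx P_unit) curv_connection_change // curv_pullback //.
  rewrite mulmx_suml mulmx_sumr; apply: eq_bigr => p _.
  rewrite mulmx_suml mulmx_sumr; apply: eq_bigr => l _.
  by rewrite -scalemxAl -scalemxAr mulmxA.
transitivity (\sum_i \sum_p \sum_l (Jac tau x i p * Jac tau x j l) *
    (invmx (P x) *m curv B p l (tau x) *m P x) i k).
  apply: eq_bigr => i _; rewrite cE summxE; apply: eq_bigr => p _.
  by rewrite summxE; apply: eq_bigr => l _; rewrite mxE.
(* Since [Jac tau x i p] is [P x p i], summing over [i] multiplies [invmx (P x)] by [P x] and leaves
   a trace in the target frame. *)
transitivity (\sum_l Jac tau x j l * \sum_p (curv B p l (tau x) *m P x) p k).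
  rewrite exchange_big /=; under eq_bigr => p _ do rewrite exchange_big /=.
  rewrite exchange_big; apply: eq_bigr => l _ /=; rewrite mulr_sumr.
  apply: eq_bigr => p _.
  rewrite -[curv B p l (tau x) *m P x in RHS](mulKVmx P_unit).
  rewrite [X in _ = _ * X]mxE mulr_sumr.
  apply: eq_bigr => i _; rewrite [P x p i]mxE mulmxA mulrA.
  by congr (_ * _); exact: mulrC.
apply: eq_bigr => l _; rewrite mulr_sumr.
under eq_bigr => p _ do rewrite [X in _ * X]mxE mulr_sumr.
rewrite exchange_big; apply: eq_bigr => t _; rewrite mulr_sumr.
by apply: eq_bigr => p _; rewrite [P x t k]mxE; ring.
Qed.

End ChangeOfCoordinates.

(** * The Levi-Civita connection in a chart *)

Section Charts.
Context {R : realType} {n : nat} {M : manifold R n}.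

Lemma img_chart_point (a : idx M) x : img (atlas a) x ->
  Defs.coord (atlas a) (Defs.point (atlas a) x) = x /\ domain a (Defs.point (atlas a) x).
Proof. by move=> [p ap <-]; rewrite Defs.coordK. Qed.

Lemma dpart_point (a : idx M) i (h : M -> R) x : img (atlas a) x ->
  dpart a i h (Defs.point (atlas a) x) = partial i (h \o Defs.point (atlas a)) x.
Proof. by move=> /img_chart_point[px _]; rewrite /dpart px. Qed.

Context (g : metric M) (a : idx M).
Local Notation U := (img (atlas a)).

Let oU : open U. Proof. exact: img_open. Qed.

Definition gmx (x : 'rV[R]_n) : 'M[R]_n := g a (Defs.point (atlas a) x).

Definition gamma (i : 'I_n) (x : 'rV[R]_n) : 'M[R]_n :=
  \matrix_(l, k) christoffel g a l i k (Defs.point (atlas a) x).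

Lemma gmx_smooth : mxsmooth U gmx.
Proof. by split=> i j; exact: Defs.metric_smooth. Qed.

Lemma gmx_sym x : U x -> (gmx x)^T = gmx x.
Proof. by move=> /img_chart_point[_ ax]; exact: Defs.metric_sym. Qed.

Lemma gmx_unit x : U x -> gmx x \in unitmx.
Proof. by move=> /img_chart_point[_ ax]; exact: Defs.metric_nondeg. Qed.

Lemma dgmx_sym m i j x : U x -> mxpartial m gmx x i j = mxpartial m gmx x j i.
Proof.
move=> Ux; rewrite [LHS]mxpartialE [RHS]mxpartialE; apply: partial_eq oU _ x Ux => y Uy.
by rewrite -[in LHS](gmx_sym Uy) mxE.
Qed.

Lemma dpart_gmx m i j x : U x ->
  dpart a m (fun q => g a q i j) (Defs.point (atlas a) x) = mxpartial m gmx x i j.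
Proof. by move=> Ux; rewrite (dpart_point _ _ Ux) mxpartialE. Qed.

Lemma gammaE i l k x : U x -> gamma i x l k =
  2^-1 * \sum_m invmx (gmx x) l m *
    (mxpartial i gmx x k m + mxpartial k gmx x i m - mxpartial m gmx x i k).
Proof.
move=> Ux; rewrite mxE /christoffel; congr (_ * _); apply: eq_bigr => m _.
by rewrite !dpart_gmx.
Qed.

Lemma gamma_smooth i : mxsmooth U (gamma i).
Proof.
have sG := gmx_smooth.
have sI := mxsmooth_entry (mxsmooth_inv oU gmx_unit sG).
have sd m := mxsmooth_entry (mxsmooth_partial oU m sG).
split=> l k.
have s1 m : smooth_on U (fun x => invmx (gmx x) l m *
    (mxpartial i gmx x k m + mxpartial k gmx x i m - mxpartial m gmx x i k)).
  apply: smooth_onM => //.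
  have sN := smooth_onM oU (@smooth_on_cst _ _ U (-1)) (sd m i k).
  apply: (smooth_on_eq oU _ (smooth_onD oU (smooth_onD oU (sd i k m) (sd k i m)) sN)).
  by move=> x _; congr (_ + _); exact: mulN1r.
apply: (smooth_on_eq oU _ (smooth_onM oU (@smooth_on_cst _ _ U 2^-1)
  (smooth_on_sum (index_enum 'I_n) oU s1))) => x Ux.
by rewrite gammaE.
Qed.

Lemma gamma_torsion_free i j l x : U x -> gamma i x l j = gamma j x l i.
Proof.
move=> Ux; rewrite !gammaE //; congr (_ * _); apply: eq_bigr => m _.
by rewrite (dgmx_sym m i j Ux) [X in _ * (X - _)]addrC.
Qed.

(** [lower] is the Koszul formula for the symbol with its upper index lowered. Adding it to itself
    with [j] and [k] exchanged leaves only the derivative in direction [i]. *)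
Lemma gamma_metric i x : U x ->
  mxpartial i gmx x = gmx x *m gamma i x + (gamma i x)^T *m gmx x.
Proof.
move=> Ux; have uG := gmx_unit Ux.
have lower j k : \sum_l gmx x j l * gamma i x l k =
    2^-1 * (mxpartial i gmx x k j + mxpartial k gmx x i j - mxpartial j gmx x i k).
  pose c m := mxpartial i gmx x k m + mxpartial k gmx x i m - mxpartial m gmx x i k.
  transitivity (2^-1 * \sum_m (gmx x *m invmx (gmx x)) j m * c m).
    under eq_bigr => l _ do rewrite gammaE // mulrCA.
    rewrite -mulr_sumr; congr (_ * _).
    under eq_bigr => l _ do rewrite mulr_sumr.
    rewrite [LHS]exchange_big; apply: eq_bigr => m _; rewrite [X in _ = X * _]mxE mulr_suml.
    by apply: eq_bigr => l _; rewrite mulrA.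
  rewrite mulmxV // (bigD1 j) //= mxE eqxx mul1r big1 ?addr0 // => m mj.
  by rewrite mxE eq_sym (negbTE mj) mul0r.
apply/matrixP => j k; rewrite [RHS]mxE [X in _ = X + _]mxE lower.
have -> : ((gamma i x)^T *m gmx x) j k = \sum_l gmx x k l * gamma i x l j.
  rewrite mxE; apply: eq_bigr => l _; rewrite [_^T _ _]mxE mulrC.
  by rewrite -[in LHS](gmx_sym Ux) [_^T _ _]mxE.
rewrite lower (dgmx_sym i k j Ux) (dgmx_sym k i j Ux) (dgmx_sym j i k Ux).
by rewrite (dgmx_sym k j i Ux) (dgmx_sym j k i Ux); field.
Qed.

Lemma ricci_curv j k x : U x ->
  ricci g a (Defs.point (atlas a) x) j k = \sum_i curv gamma i j x i k.
Proof.
move=> Ux; rewrite mxE; apply: eq_bigr => i _; rewrite /riemann /curv.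
have E p q r s : mxpartial p (gamma q) x r s
    = dpart a p (christoffel g a r q s) (Defs.point (atlas a) x).
  rewrite mxpartialE (dpart_point _ _ Ux) (_ : (fun y => _) =
    christoffel g a r q s \o Defs.point (atlas a)) //.
  by apply/funext => y; rewrite mxE.
have mxB (X Y : 'M[R]_n) l b : (X - Y) l b = X l b - Y l b by rewrite !mxE.
have mxD (X Y : 'M[R]_n) l b : (X + Y) l b = X l b + Y l b by rewrite !mxE.
rewrite !(mxB, mxD) !E sumrB addrA.
by congr (_ + _ - _); rewrite [RHS]mxE; apply: eq_bigr => m _; rewrite !mxE.
Qed.

End Charts.

(** * Schur's lemma on manifolds *)

Section RicciTensor.
Context {R : realType} {n : nat} {M : manifold R n} (g : metric M).

Lemma overlap_open (a b : idx M) :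
  open (Defs.coord (atlas a) @` (domain a `&` domain b)).
Proof.
rewrite openE => _ [p [ap bp] <-].
have Ux : img (atlas a) (Defs.coord (atlas a) p) by exists p.
have nb : \forall y \near Defs.coord (atlas a) p, domain b (Defs.point (atlas a) y).
  apply: (point_cont Ux); rewrite coordK //.
  by apply: open_nbhs_nbhs; split=> //; exact: dom_open.
have na : \forall y \near Defs.coord (atlas a) p, img (atlas a) y.
  by apply: open_nbhs_nbhs; split=> //; exact: img_open.
apply: filterS2 na nb => y /img_chart_point[yE ay] by_.
by exists (Defs.point (atlas a) y).
Qed.

Lemma ricci_transform (a b : idx M) p : domain a p -> domain b p ->
  ricci g a p = jac a b p *m ricci g b p *m (jac a b p)^T.
Proof.
move=> ap bp; pose V := Defs.coord (atlas a) @` (domain a `&` domain b).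
pose tau x := Defs.coord (atlas b) (Defs.point (atlas a) x).
have V_U x : V x -> img (atlas a) x by move=> [q [aq _] <-]; exists q.
have V_b x : V x -> domain b (Defs.point (atlas a) x).
  by move=> [q [aq bq] <-]; rewrite coordK.
have V_W x : V x -> img (atlas b) (tau x).
  by move=> /V_b bx; exists (Defs.point (atlas a) x).
have tauK x : V x -> Defs.point (atlas b) (tau x) = Defs.point (atlas a) x.
  by move=> /V_b bx; rewrite /tau coordK.
have tau_smooth j : smooth_on V (fun x => tau x 0 j) by exact: atlas_smooth.
have jacE x : V x -> jac a b (Defs.point (atlas a) x) = Jac tau x.
  move=> Vx; apply/matrixP => i j; rewrite !mxE.
  exact: dpart_point (V_U _ Vx).
have subV (X : 'rV[R]_n -> 'M[R]_n) :
    mxsmooth (img (atlas a)) X -> mxsmooth V X.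
  by move=> [sX]; split=> i j; exact: smooth_onS V_U (sX i j).
have G_change x : V x ->
    gmx g a x = Jac tau x *m gmx g b (tau x) *m (Jac tau x)^T.
  move=> Vx; rewrite -jacE // /gmx tauK //; apply: metric_trans; last exact: V_b.
  by have [] := img_chart_point (V_U _ Vx).
have Vp : V (Defs.coord (atlas a) p) by exists p.
have tp : tau (Defs.coord (atlas a) p) = Defs.coord (atlas b) p by rewrite /tau coordK.
have change j k := ricci_change (overlap_open (a := a) (b := b))
  (img_open (c := atlas b)) tau_smooth V_W
  (fun i => subV _ (gamma_smooth g a i))
  (fun x Vx => gmx_unit g (V_U x Vx))
  (fun i x Vx => gamma_metric g i (V_U x Vx))
  (fun i j l x Vx => gamma_torsion_free g i j l (V_U x Vx))
  (gmx_smooth g b) (gamma_smooth g b)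
  (fun x => gmx_sym g (x := x))
  (fun i x => gamma_metric g i (x := x))
  (fun i j l x => gamma_torsion_free g i j l (x := x))
  G_change j k Vp.
apply/matrixP => j k.
have -> : ricci g a p j k = \sum_i curv (gamma g a) i j (Defs.coord (atlas a) p) i k.
  by rewrite -ricci_curv ?coordK //; exact: V_U.
have ricci_b s t : ricci g b p s t =
    \sum_i curv (gamma g b) i s (Defs.coord (atlas b) p) i t.
  by rewrite -ricci_curv ?coordK //; exists p.
rewrite change tp -[in RHS](coordK ap) jacE //.
rewrite mxE; under [RHS]eq_bigr => t _ do rewrite mxE mulr_suml.
rewrite [RHS]exchange_big; apply: eq_bigr => l _; apply: eq_bigr => t _.
by rewrite [_^T t k]mxE coordK // ricci_b mulrAC.
Qed.

Lemma ricci_smooth (a : idx M) :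
  mxsmooth (img (atlas a)) (fun x => ricci g a (Defs.point (atlas a) x)).
Proof.
have oU : open (img (atlas a)) by exact: img_open.
split=> j k.
have sF i := mxsmooth_entry (curv_smooth oU (gamma_smooth g a) i j) i k.
apply: (smooth_on_eq oU _ (smooth_on_sum (index_enum 'I_n) oU sF)) => x Ux.
by rewrite (ricci_curv _ _ _ Ux).
Qed.

(** Ric and g change by the same congruence, so the factor cannot depend on the chart. Positive
    dimension makes the invertible matrix of g nonzero. *)
Lemma einstein_factor_unique (a b : idx M) (r s : R) p : (0 < n)%N ->
  domain a p -> domain b p ->
  ricci g a p = r *: g a p -> ricci g b p = s *: g b p -> r = s.
Proof.
move=> n0 ap bp ar bs; have := ricci_transform ap bp.
rewrite ar bs -scalemxAr -scalemxAl -(metric_trans g ap bp) => /eqP.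
rewrite -subr_eq0 -scalerBl scaler_eq0 subr_eq0 => /orP[/eqP //|/eqP g0].
have := mulVmx (Defs.metric_nondeg g ap); rewrite g0 mulmx0.
move=> /matrixP/(_ (Ordinal n0) (Ordinal n0)); rewrite !mxE eqxx => /eqP.
by rewrite eq_sym oner_eq0.
Qed.

Lemma einstein_of_pointwise_einstein (h : idx M -> M -> R) : (2 < n)%N ->
  connected [set: M] ->
  (forall a p, domain a p -> ricci g a p = h a p *: g a p) ->
  exists mu, einstein_with g mu.
Proof.
move=> n2 M_conn ric; have n0 : (0 < n)%N by exact: ltn_trans n2.
(* One chart is chosen around each point to turn the chartwise factor into a function on M; by
   uniqueness it serves in every chart. *)
have [ch chP] := choice (@atlas_cover R n M).
pose k p := h (ch p) p.
have kP a p : domain a p -> ricci g a p = k p *: g a p.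
  move=> ap; rewrite (ric a p ap); congr (_ *: _).
  exact: einstein_factor_unique n0 ap (chP p) (ric _ _ ap) (ric _ _ (chP p)).
have k_smooth a : smooth_on (img (atlas a)) (k \o Defs.point (atlas a)).
  have oU : open (img (atlas a)) by exact: img_open.
  have sI := mxsmooth_inv oU (fun x => gmx_unit g (a := a) (x := x)) (gmx_smooth g a).
  pose o := Ordinal n0.
  (* In any chart g^-1 Ric is [k] times the identity, so [k] is its first diagonal entry. *)
  apply: (smooth_on_eq oU _ (mxsmooth_entry (mxsmoothM oU sI (ricci_smooth a)) o o)).
  move=> x Ux; have [_ ax] := img_chart_point Ux.
  by rewrite kP // -scalemxAr mulVmx ?gmx_unit // !mxE eqxx mulr1.
have k_partial a i x : img (atlas a) x -> partial i (k \o Defs.point (atlas a)) x = 0.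
  apply: (schur_partial (@img_open _ _ _ (atlas a)) (gmx_smooth g a) (gamma_smooth g a)
    (fun x => gmx_sym g (x := x)) (fun x => gmx_unit g (x := x))
    (fun i x => gamma_metric g i (x := x))
    (fun i j l x => gamma_torsion_free g i j l (x := x)) (k_smooth a)) => //.
  move=> j l y Uy; have [_ ay] := img_chart_point Uy.
  by rewrite -(ricci_curv _ _ _ Uy) kP // mxE.
have k_loc p : \forall q \near p, k q = k p.
  have ap := chP p; set a := ch p in ap.
  have Up : img (atlas a) (Defs.coord (atlas a) p) by exists p.
  have := locally_constant (@img_open _ _ _ (atlas a)) (k_smooth a [::]) (k_partial a) Up.
  move=> /(coord_cont ap) loc.
  have na : \forall q \near p, domain a q.
    by apply: open_nbhs_nbhs; split=> //; exact: dom_open.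
  by apply: filterS2 na loc => q aq; rewrite /= !coordK.
(* On an empty manifold any constant serves. *)
have [[p0 _]|M0] := pselect (exists p : M, True); last first.
  by exists 0 => a p; case: M0; exists p.
exists (k p0) => a p ap; rewrite kP //; congr (_ *: _).
(* Preimages under a locally constant function are open, so the level set through [p0] is both open
   and closed. *)
have open_k (S : set R) : open (k @^-1` S).
  rewrite openE => q Sq; apply: filterS (k_loc q) => q' qq'.
  by rewrite /= /preimage /= qq'.
have : [set q | k q = k p0] = [set: M].
  apply: M_conn; first by exists p0.
    by exists (k @^-1` [set k p0]); [exact: open_k | rewrite setTI].
  exists (k @^-1` [set k p0]); last by rewrite setTI.
  rewrite -openC preimage_setC; exact: open_k.
by move=> /seteqP[_ /(_ p I)].
Qed.

End RicciTensor.

(** * From the soliton equation to the Einstein constant *)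

Theorem corollary5p4 (R : realType) (n1 n2 : nat)
  (n1_gt0 : (0 < n1)%N) (n2_gt0 : (0 < n2)%N) (n_ge3 : (3 <= n1 + n2)%N)
  (M1 : manifold R n1) (M2 : manifold R n2) (g1 : metric M1) (g2 : metric M2)
  (f phi : pos_fun (prod_manifold M1 M2))
  (M_connected : connected [set: prod_manifold M1 M2])
  (Z : vector_field (prod_manifold M1 M2)) (lam : prod_manifold M1 M2 -> R)
  (rho c : R)
  (soliton : almost_rb_soliton (lyra_metric g1 g2 f phi) Z lam rho)
  (Z_homothetic : homothetic (lyra_metric g1 g2 f phi) Z c) :
  exists mu : R,
    einstein_with (lyra_metric g1 g2 f phi) mu /\
    (forall p, lam p = (1 - (n1 + n2)%:R * rho) * mu + c) /\
    (exists l : R, forall p, lam p = l) /\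
    (rho <> ((n1 + n2)%:R)^-1 ->
      forall p, mu = (lam p - c) / (1 - (n1 + n2)%:R * rho)) /\
    (rho = ((n1 + n2)%:R)^-1 -> forall p, lam p = c).
Proof.
move: (lyra_metric g1 g2 f phi) soliton Z_homothetic => g [_ soliton] Z_homothetic.
have n0 : (0 < n1 + n2)%N by exact: ltn_trans n_ge3.
have nR0 : (n1 + n2)%:R != 0 :> R by rewrite pnatr_eq0 -lt0n.
(* Homothety makes half the Lie derivative equal to c g, so Ric is pointwise a multiple of g; the
   factor still mentions the chart through the scalar curvature. *)
have ric a p : domain a p -> ricci g a p =
    (lam p + rho * scalar_curvature g a p - c) *: g a p.
  move=> ap; have := soliton a p ap.
  rewrite (Z_homothetic a p ap) scalerA mulKf ?pnatr_eq0 //.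
  by rewrite scalerBl => <-; rewrite addrK.
have [mu mu_einstein] := einstein_of_pointwise_einstein n_ge3 M_connected ric.
have lamE p : lam p = (1 - (n1 + n2)%:R * rho) * mu + c.
  have [a ap] := atlas_cover p.
  have scalE : scalar_curvature g a p = (n1 + n2)%:R * mu.
    rewrite /scalar_curvature (mu_einstein a p ap) -scalemxAr mulVmx ?Defs.metric_nondeg //.
    by rewrite scalemx1 mxtrace_scalar mulr_natl.
  (* Within a single chart, comparing the constant with the pointwise factor and using that the
     scalar curvature is n mu gives mu = lambda + rho n mu - c. *)
  have muE := einstein_factor_unique n0 ap ap (mu_einstein a p ap) (ric a p ap).
  rewrite scalE in muE; apply: (addIr (rho * ((n1 + n2)%:R * mu) - c)).
  by rewrite addrA -muE; ring.
exists mu; split=> //; split=> //; split; first by eexists; exact: lamE.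
split=> [rho_n p|rho_n p]; last by rewrite lamE rho_n mulfV // subrr mul0r add0r.
rewrite lamE addrK mulrAC mulfV ?mul1r // subr_eq0.
apply/eqP => E; apply: rho_n; apply: (mulfI nR0).
by rewrite -E mulfV.
Qed.
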